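(* Let $n,k\ge1$ and let $P_1,\dots,P_k\in\mathbb{C}[Z_1^{\pm1},\dots,Z_n^{\pm1}]$ be nonzero Laurent polynomials. Then the generalized Mahler measure satisfies $$\lim_{\mu(A)\to\infty}m_{m,\max}\bigl(P_1^{(A)},\dots,P_k^{(A)}\bigr)=m_{n,\max}(P_1,\dots,P_k),$$ and the multiple higher Mahler measure satisfies $$\lim_{\mu(A)\to\infty}m_{m,\mathrm{prod}}\bigl(P_1^{(A)},\dots,P_k^{(A)}\bigr)=m_{n,\mathrm{prod}}(P_1,\dots,P_k),$$ where in the limits $A$ varies among $n$ by $m$ integer matrices. Here $m\ge1$ may vary in the limit, but $n$ is fixed by the choice of the $P_i$.
   Context: $\mathbb{T}^n$ is the $n$-dimensional unit torus $\{(z_1,\dots,z_n)\in\mathbb{C}^n:|z_1|=\dots=|z_n|=1\}$ with normalized Haar measure $\tau_n$ (total mass 1). Laurent polynomials are also regarded as functions on the torus. For an $n\times m$ integer matrix $A=(a_{ij})$ and $P\in\mathbb{C}[Z_1^{\pm1},\dots,Z_n^{\pm1}]$, $P^{(A)}$ is the Laurent polynomial in $m$ variables $$P^{(A)}(Z_1,\dots,Z_m)=P\bigl(Z_1^{a_{11}}\cdots Z_m^{a_{1m}},\ \dots,\ Z_1^{a_{n1}}\cdots Z_m^{a_{nm}}\bigr).$$ The Boyd height of $A$ is $\mu(A)=\min\{\|\mathbf v\|_\infty:\mathbf v\in\mathbb{Z}^n,\ \mathbf v\ne\mathbf 0,\ \mathbf v\cdot A=\mathbf 0\}$ ($\mathbf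 v$ a row vector), with $\mu(A)=\infty$ if no such $\mathbf v$ exists. For nonzero Laurent polynomials $P_1,\dots,P_k$ in $n$ variables, $m_{n,\max}(P_1,\dots,P_k)=\int_{\mathbb{T}^n}\max\{\log|P_1|,\dots,\log|P_k|\}\,d\tau_n$ and $m_{n,\mathrm{prod}}(P_1,\dots,P_k)=\int_{\mathbb{T}^n}\log|P_1|\cdots\log|P_k|\,d\tau_n$. A limit as $\mu(A)\to\infty$ means: for every $\varepsilon>0$ there is a real $M$ such that for every $m\ge1$ and every $n\times m$ integer matrix $A$ with $\mu(A)\ge M$ (including $\mu(A)=\infty$) the quantity is defined (in particular all $P_i^{(A)}$ are nonzero) and is within $\varepsilon$ of the limit. *)

(* Defs.v *)
From HB Require Import structures.
From mathcomp Require Import all_boot all_order all_algebra.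
From mathcomp Require Import finmap complex monalg.
From mathcomp Require Import all_classical all_reals all_analysis.
From mathcomp Require Import measurable_realfun.

Set Implicit Arguments.
Unset Strict Implicit.
Unset Printing Implicit Defensive.

Import Order.TTheory GRing.Theory Num.Theory.
Import numFieldNormedType.Exports.
Import ComplexField.

Local Open Scope classical_set_scope.
Local Open Scope ring_scope.

(* The Borel sigma-algebra of R[i], transported from R * R by (Re, Im). *)
Section complex_measurable.
Variable R : realType.

Definition complex_pair (z : R[i]) : measurableTypeR R * measurableTypeR R :=
  (complex.Re z, complex.Im z).

HB.instance Definition _ := isPointed.Build R[i] 0.

Definition complex_measurable : set (set R[i]) :=
  preimage_set_system setT complex_pair measurable.

Let cm_sigma_algebra : sigma_algebra setT complex_measurable.
Proof. exact/sigma_algebra_preimage/sigma_algebra_measurable. Qed.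

Let cm0 : complex_measurable set0.
Proof. by case: cm_sigma_algebra. Qed.

Let cmC A : complex_measurable A -> complex_measurable (~` A).
Proof. by case: cm_sigma_algebra => _ + _ => /[apply]; rewrite setTD. Qed.

Let cmU (F : (set R[i])^nat) : (forall i, complex_measurable (F i)) ->
  complex_measurable (\bigcup_i F i).
Proof. by case: cm_sigma_algebra => _ _; exact. Qed.

HB.instance Definition _ :=
  @isMeasurable.Build default_measure_display R[i] complex_measurable cm0 cmC cmU.

Lemma measurable_funC d (T : measurableType d) (f : T -> R[i]) :
  measurable_fun [set: T] (@complex.Re R \o f : T -> measurableTypeR R) ->
  measurable_fun [set: T] (@complex.Im R \o f : T -> measurableTypeR R) ->
  measurable_fun [set: T] f.
Proof.
move=> mRe mIm _ _ [B mB <-]; rewrite !setTI -comp_preimage.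
rewrite -[X in measurable X]setTI.
exact: (measurable_fun_pair mRe mIm measurableT mB).
Qed.

End complex_measurable.

Section haar.
Variable R : realType.

Definition torus (n : nat) : set (n.-tuple R[i]) :=
  [set z | forall i, Normc.normc (tnth z i) = 1].

Definition expi (t : measurableTypeR R) : R[i] :=
  (cos (2 * pi * t) +i* sin (2 * pi * t))%C.

Lemma measurable_expi : measurable_fun setT expi.
Proof.
apply: measurable_funC; apply: continuous_measurable_fun => t.
- apply: (@continuous_comp _ _ _ (fun t : R => 2 * pi * t) cos).
    exact: mulrl_continuous.
  exact: continuous_cos.
- apply: (@continuous_comp _ _ _ (fun t : R => 2 * pi * t) sin).
    exact: mulrl_continuous.
  exact: continuous_sin.
Qed.

HB.instance Definition _ :=
  isMeasurableFun.Build _ _ _ _ expi measurable_expi.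

(* Normalized arc length. *)
Definition haar1 : probability R[i] R :=
  distribution (uniform_prob (@ltr01 R)) expi.

Definition tuple_cons n (x : R[i] * n.-tuple R[i]) : n.+1.-tuple R[i] :=
  [tuple of x.1 :: x.2].

Lemma measurable_tuple_cons n : measurable_fun setT (@tuple_cons n).
Proof. exact: measurable_cons. Qed.

HB.instance Definition _ n :=
  isMeasurableFun.Build _ _ _ _ (@tuple_cons n) (@measurable_tuple_cons n).

(* The product measure haar1^n; it is carried by torus n, where it is the
   normalized Haar measure. *)
Fixpoint haar (n : nat) : probability (n.-tuple R[i]) R :=
  match n with
  | 0 => \d_ [tuple]
  | n'.+1 => distribution (haar1 \x haar n')%E (@tuple_cons n')
  end.

End haar.

Arguments torus R n _ : clear implicits.

Section laurent.
Variable R : realType.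

(* Laurent polynomials in n variables: P@_v is the coefficient of
   Z_1^(v_1) ... Z_n^(v_n). *)
Definition laurent (n : nat) := {malg R[i]['rV[int]_n]}.

Definition laurent_eval n (P : laurent n) (z : n.-tuple R[i]) : R[i] :=
  \sum_(v <- msupp P) P@_v * \prod_(i < n) tnth z i ^ v 0 i.

(* P^(A): the substitution Z_i := \prod_j Z_j ^ A i j maps the monomial with
   exponent v to the one with exponent v *m A. *)
Definition laurent_subst n m (P : laurent n) (A : 'M[int]_(n, m)) : laurent m :=
  \sum_(v <- msupp P) << P@_v *g v *m A >>.

Lemma laurent_evalEw n (P : laurent n) (d : {fset 'rV[int]_n}) z :
  (msupp P `<=` d)%fset ->
  laurent_eval P z = \sum_(v <- d) P@_v * \prod_(i < n) tnth z i ^ v 0 i.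
Proof.
move=> sPd; rewrite /laurent_eval; apply: big_fset_incl => // v _ vP.
by rewrite mcoeff_outdom// mul0r.
Qed.

Lemma laurent_eval_is_zmod_morphism n z :
  zmod_morphism (fun P : laurent n => laurent_eval P z).
Proof.
move=> P Q; pose d := (msupp P `|` msupp Q)%fset.
rewrite (@laurent_evalEw _ _ d) ?msuppB_le//.
rewrite (@laurent_evalEw _ P d) ?fsubsetUl//.
rewrite (@laurent_evalEw _ Q d) ?fsubsetUr//.
by rewrite -sumrB; apply: eq_bigr => v _; rewrite mcoeffB mulrBl.
Qed.

Lemma laurent_eval_subst n m (P : laurent n) (A : 'M[int]_(n, m))
    (z : m.-tuple R[i]) : (forall j, tnth z j != 0) ->
  laurent_eval (laurent_subst P A) z =
  laurent_eval P [tuple \prod_(j < m) tnth z j ^ A i j | i < n].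
Proof.
move=> z0; rewrite /laurent_subst.
pose ev := GRing.isZmodMorphism.Build _ _ _ (@laurent_eval_is_zmod_morphism m z).
pose f : {additive laurent m -> R[i]} := HB.pack (fun P : laurent m => laurent_eval P z) ev.
rewrite -[LHS]/(f _) raddf_sum; apply: eq_bigr => v _.
rewrite /= (@laurent_evalEw _ _ [fset (v *m A)%R]%fset) ?msuppU_le//.
rewrite big_seq_fset1 mcoeffUU; congr (_ * _).
under [RHS]eq_bigr do rewrite tnth_mktuple.
transitivity (\prod_(j < m) \prod_(i < n) tnth z j ^ (v 0 i * A i j)).
  apply: eq_bigr => j _; rewrite mxE.
  elim/big_ind2 : _ => [|x a y b <- <-|//]; first by rewrite expr0z.
  by rewrite expfzDr.
rewrite exchange_big; apply: eq_bigr => i _ /=.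
elim/big_ind2 : _ => [|x a y b -> ->|j _]; first by rewrite exp1rz.
  by rewrite expfzMl.
by rewrite mulrC exprz_exp.
Qed.

End laurent.

Section boyd.
Variable R : realType.

Definition supnorm n (v : 'rV[int]_n) : nat := \max_(i < n) `|v ord0 i|%N.

(* The infimum of the empty set is +oo; a nonempty set of natural numbers
   attains its infimum. *)
Definition boyd_height n m (A : 'M[int]_(n, m)) : \bar R :=
  ereal_inf [set (supnorm v)%:R%:E | v in [set v | v != 0 /\ v *m A = 0]].

(* F A tends to l as the Boyd height of A tends to infinity, A ranging over
   the integer matrices with n rows and any number m >= 1 of columns;
   defd A means that the quantity F A is defined. *)
Definition boyd_cvg n (defd : forall m, 'M[int]_(n, m) -> Prop)
    (F : forall m, 'M[int]_(n, m) -> \bar R) (l : \bar R) : Prop :=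
  forall eps : R, 0 < eps -> exists M : R,
    forall (m : nat) (A : 'M[int]_(n, m)), (1 <= m)%N ->
      (M%:E <= boyd_height A)%E ->
      defd m A /\ (`|F m A - l| < eps%:E)%E.

End boyd.

Section mahler.
Variables (R : realType) (n k : nat) (P : 'I_k -> laurent R n).
Local Open Scope ereal_scope.

(* lne 0 = -oo *)
Definition log_abs (i : 'I_k) (z : n.-tuple R[i]) : \bar R :=
  lne (Normc.normc (laurent_eval (P i) z))%:E.

Definition max_log (z : n.-tuple R[i]) : \bar R :=
  \big[maxe/-oo]_(i < k) log_abs i z.

Definition prod_log (z : n.-tuple R[i]) : \bar R :=
  \prod_(i < k) log_abs i z.

Definition mahler_max : \bar R := \int[haar R n]_(z in torus R n) max_log z.

Definition mahler_prod : \bar R := \int[haar R n]_(z in torus R n) prod_log z.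

Definition mahler_max_defined : Prop :=
  (forall i, P i != 0%R) /\ (haar R n).-integrable (torus R n) max_log.

Definition mahler_prod_defined : Prop :=
  (forall i, P i != 0%R) /\ (haar R n).-integrable (torus R n) prod_log.

End mahler.

(* Main.v *)
Require Import Defs.
From HB Require Import structures.
From mathcomp Require Import all_boot all_order all_algebra.
From mathcomp Require Import finmap complex monalg.
From mathcomp Require Import all_classical all_reals all_analysis.
From mathcomp Require Import measurable_realfun ring lra.

Set Implicit Arguments.
Unset Strict Implicit.
Unset Printing Implicit Defensive.

Import Order.TTheory GRing.Theory Num.Theory.
Import numFieldNormedType.Exports.
Import ComplexField.

Local Open Scope ring_scope.

(** The integrands are functions of the moduli of the P i, and for z on the torus
the i-th polynomial composed with A has the value of P i at the point z^A with
coordinates the monomials of A. If f is a trigonometric polynomial on the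
n-torus, then the integral of f (z^A) over the m-torus adds up the coefficients
at the exponents v with v *m A = 0; once the Boyd height of A exceeds the
exponents of f only v = 0 is left, and the integral equals that of f
(integral_real_trig_subst). So the convergence reduces to approximating the
integrand in L1 by trigonometric polynomials in the variable z^A, with an
error that is uniform in A.

Away from the zeros of the P i the approximation is uniform: ln is replaced by
its truncated expansion in the squared moduli, and the maximum, which is no
polynomial, by the mean of high powers inside the logarithm
(log_approximable_prod, log_approximable_max). Near the zeros the integrand and
its approximations grow at most like a power of the logarithm of the smallest
modulus, so it is enough that, for constants C and q < 1 independent of A, the
set where the modulus of P (z^A) is at most 2^-j has measure at most C q^j.
The layers between two such sets then contribute a convergent series with a
small tail (layered_integral_le).

The bound on the sublevel sets (trig_sublevel_bound) depends only on the number
of terms and on a lower bound for one coefficient, which A of large height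
preserves. It is proved by induction on the number of terms with a translation
argument. If Q is small at z and at w z, then so is Q(w z) - w^v Q(z), where a
chosen exponent v of Q has disappeared and the distinguished coefficient a at
the exponent u has become a (w^u - w^v). By Fubini and translation invariance
the square of the measure of the sublevel set is the mean over w of the measure
of those z; it is bounded by the induction hypothesis except for the w with
w^(u - v) close to 1, which are rare (haar_character_sublevel).

Taking for A the identity matrix, whose height is infinite, the same estimate
gives the integrability for the P i themselves. *)

(** * Rotation invariance on the circle *)

Section haar1_rotation.
Local Open Scope classical_set_scope.
Context {R : realType}.
Notation mu := (@lebesgue_measure R).

Lemma measurable_shift (s : R) :
  measurable_fun setT ((fun t => t + s) : measurableTypeR R -> measurableTypeR R).
Proof. exact: measurable_funD. Qed.

Lemma lebesgue_measure_shift (s : R) (A : set (measurableTypeR R)) :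
  measurable A -> mu ((fun t => t + s) @^-1` A) = mu A.
Proof.
move=> mA; have mS := measurable_shift s.
pose S' : {mfun measurableTypeR R >-> measurableTypeR R} :=
  HB.pack (fun t : measurableTypeR R => t + s) (isMeasurableFun.Build _ _ _ _ _ mS).
apply/esym/(@lebesgue_measure_unique R (pushforward mu S')) => //= _ [[a b]] _ <-.
rewrite /pushforward/= (_ : _ @^-1` _ = `](a - s), (b - s)]%classic); last first.
  by apply/seteqP; split=> x /=; rewrite !in_itv/= ltrBlDr lerBrDr.
rewrite !lebesgue_measure_itv/= !lte_fin ltrD2r; case: ifP => // _.
by rewrite -!EFinB; congr (_%:E); ring.
Qed.

Lemma uniform01E (A : set (measurableTypeR R)) : measurable A ->
  uniform_prob (@ltr01 R) A = mu (A `&` `[0, 1[).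
Proof.
move=> mA; rewrite /uniform_prob integral_uniform_pdf.
rewrite (eq_integral (fun=> 1%E)); last first.
  move=> x; rewrite inE => -[_] /=; rewrite in_itv/= /uniform_pdf => ->.
  by rewrite subr0 invr1.
rewrite integral_cst//=; last exact: measurableI.
rewrite mul1e.
have -> : A `&` `[0, 1] = (A `&` `[0, 1[) `|` (A `&` [set (1:R)]).
  by rewrite -setIUr setUitv1// bnd_simp.
rewrite measureU0//; [exact: measurableI|exact: measurableI|].
apply/eqP; rewrite -measure_le0 -(lebesgue_measure_set1 (1:R)).
by apply: le_measure; rewrite ?inE//; exact: measurableI.
Qed.

(** The shifted period [s, 1 + s[ is cut at 1 and its second part moved back
by 1. *)
Lemma periodic_shift_measure (s : R) (X : set (measurableTypeR R)) :
  measurable X -> (forall t, X (t + 1) <-> X t) -> 0 <= s < 1 ->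
  mu ((fun t => t + s) @^-1` X `&` `[0, 1[) = mu (X `&` `[0, 1[).
Proof.
move=> mX X1 /andP[s0 s1].
have mI (a b : R) : measurable (X `&` `[a, b[) by exact: measurableI.
have -> : (fun t => t + s) @^-1` X `&` `[0, 1[ =
    (fun t => t + s) @^-1` (X `&` `[s, 1 + s[).
  apply/seteqP; split=> t /=; rewrite !in_itv/= lerDr ltrD2r;
    by move=> [? /andP[? ?]]; split=> //; apply/andP.
rewrite lebesgue_measure_shift//.
have split_itv (a b c : R) : a <= b -> b <= c ->
    mu (X `&` `[a, c[) = (mu (X `&` `[a, b[) + mu (X `&` `[b, c[))%E.
  move=> ab bc; rewrite -measureU//.
    congr (mu _); rewrite -setIUr; congr (_ `&` _).
    by rewrite -itv_bndbnd_setU ?bnd_simp.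
  apply/seteqP; split=> // t /= [[_ +] [_]]; rewrite !in_itv/=.
  by move=> /andP[_ tb] /andP[bt _]; have := le_lt_trans bt tb; rewrite ltxx.
rewrite (split_itv s 1 (1 + s)) ?lerDl//; last exact: ltW.
rewrite (split_itv 0 s 1)//; last exact: ltW.
rewrite addeC; congr (_ + _)%E.
rewrite -(lebesgue_measure_shift 1)//; congr (mu _).
apply/seteqP; split=> t /=; rewrite !in_itv/= lerDr (addrC 1) ltrD2r;
  by move=> [/X1 ? /andP[? ?]]; split=> //; apply/andP.
Qed.

Lemma expiD (s t : R) : expi (s + t) = expi s * expi t.
Proof.
rewrite /expi mulrDr cosD sinD; apply/eqP; rewrite eq_complex/=.
by apply/andP; split; apply/eqP; ring.
Qed.

Lemma expi1 : expi (1 : R) = 1.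
Proof.
rewrite /expi mulr1 (mulrC 2) mulr_natr cos2pi sin2pi.
by apply/eqP; rewrite eq_complex/= !eqxx.
Qed.

Lemma normc_expi (t : R) : Normc.normc (expi t) = 1.
Proof. by rewrite /Normc.normc/= cos2Dsin2 sqrtr1. Qed.

(** Polar form: the half-circle is covered by acos, and the sign of the
imaginary part selects the half. *)
Lemma circle_expi (z : R[i]) : Normc.normc z = 1 ->
  exists2 s : R, 0 <= s < 1 & expi s = z.
Proof.
case: z => x y; rewrite /Normc.normc/= => /(congr1 (fun u => u ^+ 2)).
rewrite sqr_sqrtr ?addr_ge0 ?sqr_ge0// expr1n => xy1.
have x11 : -1 <= x <= 1.
  rewrite -ler_norml -(@ler_pXn2r _ 2)// ?nnegrE// real_normK ?num_real// expr1n.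
  by rewrite -xy1 lerDl sqr_ge0.
have pi20 : 2 * pi != 0 :> R by rewrite mulf_neq0// ?gt_eqF// pi_gt0.
have sq : Num.sqrt (1 - x ^+ 2) = `|y| by rewrite -xy1 addrC addKr sqrtr_sqr.
have a0 := @acos_ge0 R x x11; have api := @acos_lepi R x x11.
have pi0 := @pi_gt0 R.
have [y0|y0] := leP 0 y.
  exists (acos x / (2 * pi)).
    rewrite divr_ge0 ?mulr_ge0 ?pi_ge0//= ltr_pdivrMr ?mulr_gt0// mul1r.
    by rewrite (le_lt_trans api)// ltr_pMl// ltr1n.
  by rewrite /expi mulrC divfK// acosK ?in_itv//= sin_acos// sq ger0_norm.
exists (1 - acos x / (2 * pi)).
  have apos : 0 < acos x.
    apply: acos_gt0; rewrite lt_neqAle; move: x11 => /andP[-> ->]; rewrite andbT.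
    apply: contraTN y0 => /eqP x1; move: xy1; rewrite x1 expr1n.
    move=> /(canRL (addKr _)); rewrite addNr => /eqP; rewrite sqrf_eq0 => /eqP ->.
    by rewrite ltxx.
  rewrite subr_ge0 ltrBlDr ltrDl divr_gt0 ?mulr_gt0// andbT.
  by rewrite ler_pdivrMr ?mulr_gt0// mul1r (le_trans api)// ler_pMl// ler1n.
rewrite expiD expi1 mul1r /expi mulrN cosN sinN mulrC divfK//.
by rewrite acosK ?in_itv//= sin_acos// sq ltr0_norm// opprK.
Qed.

Lemma haar1_rotation (w : R[i]) (E : set R[i]) : measurable E ->
  Normc.normc w = 1 -> haar1 R [set z | E (w * z)] = haar1 R E.
Proof.
move=> mE /circle_expi[s s01 <-].
have me (B : set R[i]) : measurable B -> measurable (@expi R @^-1` B).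
  by move=> mB; rewrite -[X in measurable X]setTI; exact: measurable_expi.
change (uniform_prob (@ltr01 R) (@expi R @^-1` [set z | E (expi s * z)]) =
  uniform_prob (@ltr01 R) (@expi R @^-1` E)).
have -> : @expi R @^-1` [set z | E (expi s * z)] =
    (fun t => t + s) @^-1` (@expi R @^-1` E).
  by apply/seteqP; split=> t /=; rewrite -expiD addrC.
rewrite !uniform01E//; last 2 first.
- exact: me.
- by rewrite -[X in measurable X]setTI; apply: measurable_shift => //; exact: me.
apply: periodic_shift_measure => //; first exact: me.
by move=> t /=; rewrite expiD expi1 mulr1.
Qed.

End haar1_rotation.

(** * Measurability of complex-valued functions *)

Section complex_measurability.
Local Open Scope classical_set_scope.
Context {R : realType}.

Lemma measurable_complex_pair : measurable_fun setT (@complex_pair R).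
Proof. by move=> _ B mB; rewrite setTI; exists B => //; rewrite setTI. Qed.

Lemma measurable_Re :
  measurable_fun setT (@complex.Re R : R[i] -> measurableTypeR R).
Proof.
rewrite (_ : complex.Re (R:=R) = fst \o (@complex_pair R))//.
by apply: measurableT_comp => //; exact: measurable_complex_pair.
Qed.

Lemma measurable_Im :
  measurable_fun setT (@complex.Im R : R[i] -> measurableTypeR R).
Proof.
rewrite (_ : complex.Im (R:=R) = snd \o (@complex_pair R))//.
by apply: measurableT_comp => //; exact: measurable_complex_pair.
Qed.

Lemma measurable_invr : measurable_fun setT
  ((fun x => x^-1) : measurableTypeR R -> measurableTypeR R).
Proof.
(* Squaring first makes the real power usable at negative x. *)
have -> : (fun x : R => x^-1) = fun x => x * (powR (x ^+ 2) (-1)).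
  apply/funext => x; rewrite powR_inv1 ?sqr_ge0//.
  have [->|x0] := eqVneq x 0; first by rewrite invr0 mul0r.
  by rewrite expr2 invfM mulrA divff// mul1r.
apply: measurable_funM => //.
exact: (measurableT_comp (@measurable_powR R (-1)) (exprn_measurable 2)).
Qed.

Context d (T : measurableType d).
Implicit Types f g : T -> R[i].

Lemma measurable_funC_Re f : measurable_fun setT f ->
  measurable_fun setT (fun t => complex.Re (f t) : measurableTypeR R).
Proof. exact: (measurableT_comp measurable_Re). Qed.

Lemma measurable_funC_Im f : measurable_fun setT f ->
  measurable_fun setT (fun t => complex.Im (f t) : measurableTypeR R).
Proof. exact: (measurableT_comp measurable_Im). Qed.

Lemma measurable_funCD f g : measurable_fun setT f -> measurable_fun setT g ->
  measurable_fun setT (fun t => f t + g t).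
Proof.
move=> mf mg; apply: measurable_funC.
  rewrite (_ : _ \o _ = fun t => complex.Re (f t) + complex.Re (g t)).
    by apply: measurable_funD; exact: measurable_funC_Re.
  by apply/funext => t /=; case: (f t) => ? ?; case: (g t).
rewrite (_ : _ \o _ = fun t => complex.Im (f t) + complex.Im (g t)).
  by apply: measurable_funD; exact: measurable_funC_Im.
by apply/funext => t /=; case: (f t) => ? ?; case: (g t).
Qed.

Lemma measurable_funCM f g : measurable_fun setT f -> measurable_fun setT g ->
  measurable_fun setT (fun t => f t * g t).
Proof.
move=> mf mg; apply: measurable_funC.
  rewrite (_ : _ \o _ = fun t => complex.Re (f t) * complex.Re (g t) -
      complex.Im (f t) * complex.Im (g t)).
    by apply: measurable_funB; apply: measurable_funM;
      do ?[exact: measurable_funC_Re|exact: measurable_funC_Im].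
  by apply/funext => t /=; case: (f t) => ? ?; case: (g t).
rewrite (_ : _ \o _ = fun t => complex.Re (f t) * complex.Im (g t) +
    complex.Im (f t) * complex.Re (g t)).
  by apply: measurable_funD; apply: measurable_funM;
    do ?[exact: measurable_funC_Re|exact: measurable_funC_Im].
by apply/funext => t /=; case: (f t) => ? ?; case: (g t).
Qed.

Lemma measurable_funCV f : measurable_fun setT f ->
  measurable_fun setT (fun t => (f t)^-1).
Proof.
move=> mf.
pose q t : measurableTypeR R := (complex.Re (f t) ^+ 2 + complex.Im (f t) ^+ 2)^-1.
have mq : measurable_fun setT q.
  apply: (measurableT_comp measurable_invr); apply: measurable_funD;
    apply: measurable_funX.
    exact: measurable_funC_Re.
  exact: measurable_funC_Im.
apply: measurable_funC.
  rewrite (_ : _ \o _ = fun t => complex.Re (f t) * q t).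
    by apply: measurable_funM => //; exact: measurable_funC_Re.
  by apply/funext => t; rewrite /q /=; case: (f t).
rewrite (_ : _ \o _ = fun t => - (complex.Im (f t) * q t)).
  by apply: measurable_funN; apply: measurable_funM => //; exact: measurable_funC_Im.
by apply/funext => t; rewrite /q /=; case: (f t).
Qed.

Lemma measurable_funCXz f (k : int) : measurable_fun setT f ->
  measurable_fun setT (fun t => f t ^ k).
Proof.
move=> mf.
have mX (n : nat) : measurable_fun setT (fun t => f t ^+ n).
  elim: n => [|n IH]; first by under eq_fun do rewrite expr0; exact: measurable_cst.
  by under eq_fun do rewrite exprS; exact: measurable_funCM.
case: k => n; first exact: mX.
exact: measurable_funCV.
Qed.

Lemma measurable_funC_sum (I : Type) (r : seq I) (F : I -> T -> R[i]) :
  (forall i, measurable_fun setT (F i)) ->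
  measurable_fun setT (fun t => \sum_(i <- r) F i t).
Proof.
move=> mF; elim: r => [|i r IH].
  by under eq_fun do rewrite big_nil; exact: measurable_cst.
by under eq_fun do rewrite big_cons; exact: measurable_funCD.
Qed.

Lemma measurable_funC_prod (I : Type) (r : seq I) (F : I -> T -> R[i]) :
  (forall i, measurable_fun setT (F i)) ->
  measurable_fun setT (fun t => \prod_(i <- r) F i t).
Proof.
move=> mF; elim: r => [|i r IH].
  by under eq_fun do rewrite big_nil; exact: measurable_cst.
by under eq_fun do rewrite big_cons; exact: measurable_funCM.
Qed.

Lemma measurable_normc f : measurable_fun setT f ->
  measurable_fun setT (fun t => Normc.normc (f t) : measurableTypeR R).
Proof.
move=> mf.
pose q t : R := complex.Re (f t) ^+ 2 + complex.Im (f t) ^+ 2.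
rewrite (_ : (fun t => _) = (@powR R ^~ (2^-1)) \o q).
  apply: (measurableT_comp (@measurable_powR R _)); apply: measurable_funD;
    apply: measurable_funX.
    exact: measurable_funC_Re.
  exact: measurable_funC_Im.
apply/funext => t /=; rewrite /q powR12_sqrt ?addr_ge0 ?sqr_ge0//.
by rewrite /Normc.normc; case: (f t).
Qed.

End complex_measurability.

(** * Translation invariance on the torus *)

Section haar_translation.
Local Open Scope classical_set_scope.
Context {R : realType}.

Definition tmul n (w z : n.-tuple R[i]) : n.-tuple R[i] :=
  [tuple tnth w i * tnth z i | i < n].

Lemma measurable_preimageT d d' (X : measurableType d) (Y : measurableType d')
    (f : X -> Y) (E : set Y) : measurable_fun setT f -> measurable E ->
  measurable (f @^-1` E).
Proof. by move=> mf mE; rewrite -[X in measurable X]setTI; exact: mf. Qed.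

Lemma measurable_tnthC n (i : 'I_n) :
  measurable_fun setT (fun z : n.-tuple R[i] => tnth z i).
Proof. exact: measurable_tnth. Qed.

Lemma measurable_torus n : measurable (torus R n).
Proof.
rewrite (_ : torus R n = \bigcap_(i in [set: 'I_n])
    ((fun z : n.-tuple R[i] => Normc.normc (tnth z i) : measurableTypeR R) @^-1` [set 1])).
  apply: fin_bigcap_measurable => [|i _]; first exact: finite_finset.
  apply: measurable_preimageT => //.
  by apply: measurable_normc; exact: measurable_tnthC.
by apply/seteqP; split=> z Hz i; [move=> _|]; exact: (Hz i).
Qed.

Lemma haarS n (E : set (n.+1.-tuple R[i])) :
  haar R n.+1 E =
  (\int[haar1 R]_x haar R n (xsection (@tuple_cons R n @^-1` E) x))%E.
Proof. by []. Qed.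

Lemma haar_torus n : haar R n (torus R n) = 1%E.
Proof.
elim: n => [|n IH].
  rewrite /= diracE (_ : _ \in _)// inE; by move=> [].
change ((haar1 R \x haar R n)%E (@tuple_cons R n @^-1` torus R n.+1) = 1%E).
have -> : @tuple_cons R n @^-1` torus R n.+1 =
    [set z | Normc.normc z = 1] `*` torus R n.
  apply/seteqP; split=> -[x z] /=.
    move=> Hz; split; first by have := Hz ord0.
    by move=> i; have := Hz (lift ord0 i); rewrite /= tnthS.
  by move=> [Hx Hz] i; case: (unliftP ord0 i) => [j|] ->//; rewrite /= tnthS.
have mC : measurable [set z : R[i] | Normc.normc z = 1].
  apply: (@measurable_preimageT _ _ _ (measurableTypeR R) (@Normc.normc R) [set 1]) => //.
  by apply: measurable_normc; exact: measurable_id.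
have h1 : haar1 R [set z : R[i] | Normc.normc z = 1] = 1%E.
  rewrite -(probability_setT (haar1 R)).
  change (uniform_prob (@ltr01 R) (@expi R @^-1` [set z | Normc.normc z = 1]) =
    uniform_prob (@ltr01 R) (@expi R @^-1` setT)).
  congr (uniform_prob _ _); apply/seteqP; split=> // t _ /=; exact: normc_expi.
transitivity (haar1 R [set z : R[i] | Normc.normc z = 1%R] * haar R n (torus R n))%E.
  by apply: product_measure1E => //; exact: measurable_torus.
by rewrite h1 mul1e IH.
Qed.

Lemma measurable_tmul n (w : n.-tuple R[i]) : measurable_fun setT (tmul w).
Proof.
apply/measurable_fun_tnthP => i.
rewrite (_ : _ \o _ = fun z => tnth w i * tnth z i).
  by apply: measurable_funCM; [exact: measurable_cst|exact: measurable_tnthC].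
by apply/funext => z /=; rewrite tnth_mktuple.
Qed.

(** Induction on the dimension: the fibre over x of the translate of E by w is a
translate of the fibre of E over w_0 x, and the circle is rotation invariant. *)
Lemma haar_translation n (w : n.-tuple R[i]) (E : set (n.-tuple R[i])) :
  torus R n w -> measurable E -> haar R n (tmul w @^-1` E) = haar R n E.
Proof.
elim: n w E => [|n IH] w E tw mE.
  by congr (haar R 0 _); apply/seteqP; split=> z /=; rewrite [tmul w z]tuple0 (tuple0 z).
rewrite !haarS.
case/tupleP: w tw => w0 w' tw.
have tw0 : Normc.normc w0 = 1 by have := tw ord0.
have tw' : torus R n w' by move=> i; have := tw (lift ord0 i); rewrite tnthS.
have mcE : measurable (@tuple_cons R n @^-1` E).
  by apply: measurable_preimageT => //; exact: measurable_tuple_cons.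
pose phi x := haar R n (xsection (@tuple_cons R n @^-1` E) x).
have mphi : measurable_fun setT phi by exact: measurable_fun_xsection.
transitivity (\int[haar1 R]_x phi (w0 * x)%R)%E.
  apply: eq_integral => x _; rewrite /phi -(IH w' (xsection (@tuple_cons R n @^-1` E) (w0 * x)))//.
    congr (haar R n _); apply/seteqP; split=> z /=; rewrite /xsection/= !inE/=;
      congr (E _); apply: eq_from_tnth => i; rewrite tnth_mktuple;
      by case: (unliftP ord0 i) => [j|] -> /=; rewrite ?tnthS ?tnth_mktuple.
  exact: measurable_xsection.
have mw0 : measurable_fun setT (fun x : R[i] => w0 * x).
  by apply: measurable_funCM; [exact: measurable_cst|exact: measurable_id].
pose W : {mfun R[i] >-> R[i]} :=
  HB.pack (fun x : R[i] => w0 * x) (isMeasurableFun.Build _ _ _ _ _ mw0).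
have := @ge0_integral_pushforward _ _ _ _ R _ mw0 (haar1 R) setT phi measurableT mphi.
rewrite preimage_setT /= => <-; last by move=> y _; exact: measure_ge0.
apply: (@eq_measure_integral _ _ _ setT (haar1 R) (pushforward (haar1 R) W)).
by move=> A mA _; exact: haar1_rotation.
Qed.

End haar_translation.

(** * Characters of the torus *)

Section characters.
Local Open Scope classical_set_scope.
Context {R : realType}.

Definition mono n (v : 'rV[int]_n) (z : n.-tuple R[i]) : R[i] :=
  \prod_(i < n) tnth z i ^ v 0 i.

Lemma torus_neq0 n (z : n.-tuple R[i]) i : torus R n z -> tnth z i != 0.
Proof.
move=> tz; apply/eqP => z0; have := tz i.
by rewrite z0 Normc.normc0 => /esym/eqP; rewrite oner_eq0.
Qed.

Lemma normc_exprz (x : R[i]) (k : int) : Normc.normc x = 1 ->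
  Normc.normc (x ^ k) = 1.
Proof.
move=> x1; have X (m : nat) : Normc.normc (x ^+ m) = 1.
  elim: m => [|m IH]; first by rewrite expr0 Normc.normc1.
  by rewrite exprS Normc.normcM x1 IH mulr1.
by case: k => m; [exact: X|rewrite NegzE -exprnN Normc.normcV X invr1].
Qed.

Lemma normc_prod (I : Type) (r : seq I) (F : I -> R[i]) :
  Normc.normc (\prod_(i <- r) F i) = \prod_(i <- r) Normc.normc (F i).
Proof.
elim: r => [|i r IH]; first by rewrite !big_nil Normc.normc1.
by rewrite !big_cons Normc.normcM IH.
Qed.

Lemma normc_mono n (v : 'rV[int]_n) z : torus R n z ->
  Normc.normc (mono v z) = 1.
Proof.
by move=> tz; rewrite normc_prod big1// => i _; apply: normc_exprz; exact: tz.
Qed.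

Lemma mono_neq0 n (v : 'rV[int]_n) z : torus R n z -> mono v z != 0.
Proof.
move=> /(normc_mono v) + ; apply: contra_eqN => /eqP ->.
by rewrite Normc.normc0 eq_sym oner_eq0.
Qed.

Lemma monoD n (u v : 'rV[int]_n) z : torus R n z ->
  mono (u + v) z = mono u z * mono v z.
Proof.
move=> tz; rewrite /mono -big_split; apply: eq_bigr => i _ /=.
by rewrite mxE expfzDr//; exact: torus_neq0.
Qed.

Lemma mono0 n z : mono (0 : 'rV[int]_n) z = 1.
Proof. by rewrite /mono big1// => i _; rewrite mxE. Qed.

Lemma mono_tmul n (v : 'rV[int]_n) w z :
  mono v (tmul w z) = mono v w * mono v z.
Proof.
rewrite /mono -big_split; apply: eq_bigr => i _ /=.
by rewrite tnth_mktuple expfzMl.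
Qed.

Lemma torus_tmul n (w z : n.-tuple R[i]) :
  torus R n w -> torus R n (tmul w z) <-> torus R n z.
Proof.
by move=> tw; split=> tz i; have := tz i; rewrite tnth_mktuple Normc.normcM tw mul1r.
Qed.

Lemma tmulC n (w z : n.-tuple R[i]) : tmul w z = tmul z w.
Proof. by apply: eq_from_tnth => i; rewrite !tnth_mktuple mulrC. Qed.

Lemma measurable_mono n (v : 'rV[int]_n) : measurable_fun setT (mono v).
Proof.
apply: measurable_funC_prod => i; apply: measurable_funCXz.
exact: measurable_tnthC.
Qed.

Lemma expi_neq0 (s : R) : expi s != 0.
Proof.
apply/eqP => e0; have := normc_expi s.
by rewrite e0 Normc.normc0 => /esym/eqP; rewrite oner_eq0.
Qed.

Lemma expi_exprz (s : R) (k : int) : expi s ^ k = expi (s * k%:~R).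
Proof.
have X (m : nat) : expi s ^+ m = expi (s * m%:R).
  elim: m => [|m IH].
    by rewrite expr0 mulr0 /expi mulr0 cos0 sin0.
  by rewrite exprSr IH -expiD -natr1 mulrDr mulr1.
case: k => m; first by rewrite -exprnP X.
rewrite NegzE -exprnN X; apply: (@mulIf _ (expi (s * m.+1%:R))).
  exact: expi_neq0.
rewrite mulVf ?expi_neq0// -expiD -mulrDr rmorphN/= -pmulrn addNr mulr0.
by rewrite /expi mulr0 cos0 sin0.
Qed.

(** The character v takes the value -1: turn one coordinate with nonzero
exponent k by the angle pi / k. *)
Lemma mono_eqN1 n (v : 'rV[int]_n) : v != 0 ->
  exists2 u, torus R n u & mono v u = -1.
Proof.
move=> /rV0Pn[j vj].
exists [tuple if i == j then expi (2^-1 / (v 0 j)%:~R) else 1 | i < n].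
  by move=> i; rewrite tnth_mktuple; case: ifP => _; rewrite ?normc_expi ?Normc.normc1.
rewrite /mono (bigD1 j)//= big1 => [|i /negbTE ij]; last first.
  by rewrite tnth_mktuple ij exp1rz.
rewrite tnth_mktuple eqxx expi_exprz mulr1 divfK ?intr_eq0//.
rewrite /expi mulrAC divff// mul1r cospi sinpi.
by apply/eqP; rewrite eq_complex/= oppr0 !eqxx.
Qed.

End characters.

(** * Sublevel sets of trigonometric polynomials *)

Section sublevel.
Local Open Scope classical_set_scope.
Context {R : realType}.

Definition character_sublevel n (v : 'rV[int]_n) (j : nat) : set (n.-tuple R[i]) :=
  [set z | torus R n z /\ Normc.normc (mono v z - 1) <= 2^-1 ^+ j].

Lemma measurable_normc_le n (f : n.-tuple R[i] -> R[i]) (c : R) :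
  measurable_fun setT f ->
  measurable [set z | torus R n z /\ Normc.normc (f z) <= c].
Proof.
move=> mf; apply: (@measurableI _ _ (torus R n) [set z | Normc.normc (f z) <= c]).
  exact: measurable_torus.
have -> : [set z | Normc.normc (f z) <= c] =
    (fun z => Normc.normc (f z) : measurableTypeR R) @^-1` `]-oo, c]%classic.
  by apply/seteqP; split=> z /=; rewrite in_itv.
by apply: measurable_preimageT; [exact: measurable_normc|exact: measurable_itv].
Qed.

Lemma measurable_character_sublevel n (v : 'rV[int]_n) j :
  measurable (character_sublevel v j).
Proof.
apply: measurable_normc_le; apply: measurable_funCD; last exact: measurable_cst.
exact: measurable_mono.
Qed.

Lemma normc_ge0 (x : R[i]) : 0 <= Normc.normc x.
Proof. by case: x => a b; exact: sqrtr_ge0. Qed.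

Lemma normcD (x y : R[i]) : Normc.normc (x + y) <= Normc.normc x + Normc.normc y.
Proof. exact: le_normcD. Qed.

Lemma normcB (x y : R[i]) : Normc.normc (x - y) <= Normc.normc x + Normc.normc y.
Proof. by rewrite (le_trans (normcD _ _))// normcN. Qed.

Lemma normc_natr (k : nat) : Normc.normc (k%:R : R[i]) = k%:R.
Proof. by have := @normcMn R 1 k; rewrite Normc.normc1. Qed.

(** Let u^v = -1. The sublevel set at level j + 1 and its translate by u are
disjoint and of equal measure, and both lie in the sublevel set of 2 v at level
j because z^(2 v) - 1 = (z^v - 1) (z^v + 1). So each level halves the measure,
whatever v is. *)
Lemma haar_character_sublevel n (v : 'rV[int]_n) j : v != 0 ->
  (haar R n (character_sublevel v j) <= (2^-1 ^+ j)%:E)%E.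
Proof.
elim: j v => [|j IH] v v0.
  by rewrite expr0 probability_le1//; exact: measurable_character_sublevel.
have [u tu vu] := mono_eqN1 (R := R) v0.
have mE := measurable_character_sublevel v j.+1.
have EP z : character_sublevel v j.+1 z -> torus R n z /\
  Normc.normc (mono v z - 1) <= 2^-1 ^+ j.+1 by [].
have E'P z : character_sublevel v j.+1 (tmul u z) -> torus R n z /\
    Normc.normc (mono v z + 1) <= 2^-1 ^+ j.+1.
  move=> [/(torus_tmul _ tu) tz]; rewrite mono_tmul vu mulN1r -opprD normcN.
  by [].
move: mE EP E'P; set E := character_sublevel v j.+1; clearbody E => mE EP E'P.
have hE' := haar_translation tu mE.
have : measurable (tmul u @^-1` E).
  by apply: measurable_preimageT; [exact: measurable_tmul|exact: mE].
have {}E'P z : (tmul u @^-1` E) z -> torus R n z /\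
  Normc.normc (mono v z + 1) <= 2^-1 ^+ j.+1 by exact: E'P.
move: hE' E'P; set E' := _ @^-1` E; clearbody E' => hE' E'P mE'.
have j12 : 2^-1 ^+ j.+1 <= 2^-1 :> R.
  by rewrite exprS ger_pMr ?invr_gt0// exprn_ile1 ?invf_le1 ?ler1n// invr_ge0.
have dis : E `&` E' = set0.
  apply/seteqP; split=> // z [/EP[_ z1] /E'P[_ z2]].
  have := normcB (mono v z + 1) (mono v z - 1).
  have -> : mono v z + 1 - (mono v z - 1) = 2%:R by ring.
  rewrite normc_natr.
  move=> h; have := le_trans h (lerD z2 z1); lra.
have sub : E `|` E' `<=` character_sublevel (v + v) j.
  have n2 z : torus R n z -> mono (v + v) z - 1 = (mono v z - 1) * (mono v z + 1).
    by move=> tz; rewrite monoD//; ring.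
  have h2 (x : R) : x <= 2^-1 ^+ j.+1 -> x * 2 <= 2^-1 ^+ j.
    by rewrite exprS => h; lra.
  move=> z [/EP[tz z1]|/E'P[tz z1]]; split=> //; rewrite n2// Normc.normcM.
    apply: le_trans (h2 _ z1); apply: ler_wpM2l; first exact: normc_ge0.
    apply: le_trans (normcD _ _) _; rewrite normc_mono// Normc.normc1.
    by rewrite -[1 + 1]/(2%:R).
  rewrite mulrC; apply: le_trans (h2 _ z1); apply: ler_wpM2l; first exact: normc_ge0.
  apply: le_trans (normcB _ _) _; rewrite normc_mono// Normc.normc1.
  by rewrite -[1 + 1]/(2%:R).
have vv0 : v + v != 0.
  move/rV0Pn: v0 => [i vi]; apply/rV0Pn; exists i; by rewrite mxE -mulr2n mulrn_eq0 negb_or.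
have : (haar R n (E `|` E') <= (2^-1 ^+ j)%:E)%E.
  apply: le_trans (IH _ vv0); apply: le_measure sub; rewrite inE.
    exact: measurableU.
  exact: measurable_character_sublevel.
have hU : haar R n (E `|` E') = (haar R n E + haar R n E')%E.
  exact: (measureU (haar R n) mE mE' dis).
rewrite hU hE'.
have fE : haar R n E \is a fin_num by exact: fin_num_measure.
rewrite -(fineK fE) -EFinD !lee_fin exprS => h; lra.
Qed.

Definition selfcorrelation_set n (E : set (n.-tuple R[i])) :
    set (n.-tuple R[i] * n.-tuple R[i]) :=
  [set p | E p.2 /\ E (tmul p.1 p.2)].

Lemma measurable_selfcorrelation_set n (E : set (n.-tuple R[i])) :
  measurable E -> measurable (selfcorrelation_set E).
Proof.
move=> mE.
apply: (@measurableI _ _ (snd @^-1` E) ((fun p => tmul p.1 p.2) @^-1` E)).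
  by apply: measurable_preimageT.
apply: measurable_preimageT => //; apply/measurable_fun_tnthP => i.
rewrite (_ : _ \o _ = fun p => tnth p.1 i * tnth p.2 i).
  apply: measurable_funCM.
    exact: (measurableT_comp (measurable_tnthC i) measurable_fst).
  exact: (measurableT_comp (measurable_tnthC i) measurable_snd).
by apply/funext => p /=; rewrite tnth_mktuple.
Qed.

Lemma xsection_selfcorrelation_set n (E : set (n.-tuple R[i])) w :
  xsection (selfcorrelation_set E) w = E `&` tmul w @^-1` E.
Proof. by apply/seteqP; split=> z; rewrite /xsection/= inE. Qed.

(** Fubini on the set of pairs (w, z) with z and w z both in E, whose fibres
over z are translates of E. *)
Lemma haar_selfcorrelation n (E : set (n.-tuple R[i])) :
  measurable E -> E `<=` torus R n ->
  (\int[haar R n]_w haar R n (E `&` tmul w @^-1` E) = haar R n E * haar R n E)%E.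
Proof.
move=> mE Et; have mG := measurable_selfcorrelation_set mE.
have := @indic_fubini_tonelli _ _ _ _ R (haar R n) (haar R n) _ mG.
rewrite indic_fubini_tonelli_FE// indic_fubini_tonelli_GE// => FG.
transitivity (\int[haar R n]_x (haar R n \o xsection (selfcorrelation_set E)) x)%E.
  by apply: eq_integral => w _ /=; rewrite xsection_selfcorrelation_set.
rewrite FG.
transitivity (\int[haar R n]_z (haar R n E * (\1_E z)%:E))%E.
  apply: eq_integral => z _ /=; rewrite indicE.
  have [Ez|Ez] := boolP (z \in E).
    rewrite mule1 -(@haar_translation _ _ z E)//; last by apply: Et; rewrite inE in Ez.
    congr (haar R n _); apply/seteqP; split=> w; rewrite /ysection/= inE/= tmulC.
      by case.
    by move=> ?; split=> //; rewrite inE in Ez.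
  rewrite mule0 (_ : ysection _ _ = set0) ?measure0//.
  apply/seteqP; split=> w //; rewrite /ysection/= inE/= => -[Ez' _].
  by move: Ez; rewrite notin_setE.
rewrite ge0_integralZl//=; last exact/measurable_EFinP/measurable_indic.
by rewrite integral_indic// setIT.
Qed.

(** A list of coefficients and exponents may repeat exponents, so terms can be
removed, changed or substituted without collecting coefficients. *)
Definition trig n (s : seq (R[i] * 'rV[int]_n)) (z : n.-tuple R[i]) : R[i] :=
  \sum_(p <- s) p.1 * mono p.2 z.

Lemma measurable_trig n s : measurable_fun setT (@trig n s).
Proof.
apply: measurable_funC_sum => p; apply: measurable_funCM; first exact: measurable_cst.
exact: measurable_mono.
Qed.

Definition trig_sublevel n (s : seq (R[i] * 'rV[int]_n)) (j : nat) :
    set (n.-tuple R[i]) :=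
  [set z | torus R n z /\ Normc.normc (trig s z) <= 2^-1 ^+ j].

Lemma measurable_trig_sublevel n s j : measurable (@trig_sublevel n s j).
Proof. by apply: measurable_normc_le; exact: measurable_trig. Qed.

Lemma subset_trig_sublevel n s i j : (i <= j)%N ->
  @trig_sublevel n s j `<=` trig_sublevel s i.
Proof.
move=> ij z [tz h]; split=> //; apply: le_trans h _.
by rewrite ler_wiXn2l// ?invr_ge0// invf_le1 ?ler1n.
Qed.

Lemma trig_cons n (a : R[i]) (v : 'rV[int]_n) s z :
  trig ((a, v) :: s) z = a * mono v z + trig s z.
Proof. by rewrite /trig big_cons. Qed.

Lemma trig_nil n z : trig ([::] : seq (R[i] * 'rV[int]_n)) z = 0.
Proof. by rewrite /trig big_nil. Qed.

(** Terms with exponent v cancel in Q(w z) - w^v Q(z). *)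
Lemma trig_twist n (c : R[i]) (v : 'rV[int]_n) (s : seq (R[i] * 'rV[int]_n)) w z :
  trig [seq (c * (p.1 * (mono p.2 w - mono v w)), p.2) | p <- s] z =
  c * (trig s (tmul w z) - mono v w * trig s z).
Proof.
elim: s => [|[a u] s IH]; first by rewrite [map _ _]/= !trig_nil mulr0 subr0 mulr0.
rewrite [map _ _]/= !trig_cons IH mono_tmul.
by move: (trig _ _) (trig _ _) (mono _ _) (mono _ _) (mono _ _) => *; ring.
Qed.

(** The square of the measure of E is the mean over w of the measure of the z with
z and w z in E. For such z the difference Q(w z) - w^v Q(z) is at most twice
the bound on Q, it has one term less than Q, and its coefficient at v1 is
a1 (w^v1 - w^v), which is small only for w in a small set. The factor 2^i
normalizes that coefficient and costs i + 1 levels. *)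
Lemma trig_sublevel_step n (a1 a : R[i]) (v1 v : 'rV[int]_n)
    (s : seq (R[i] * 'rV[int]_n)) i j (D : R) :
  0 <= D -> 1 <= Normc.normc a1 -> v != v1 -> {in s, forall p, p.2 != v1} ->
  (forall b (s' : seq (R[i] * 'rV[int]_n)), 1 <= Normc.normc b ->
    size s' = size s -> {in s', forall p, p.2 != v1} ->
    (haar R n (trig_sublevel ((b, v1) :: s') j) <= D%:E)%E) ->
  let E := trig_sublevel ((a1, v1) :: (a, v) :: s) (i + j).+1 in
  ((haar R n E * haar R n E)%E <= (2^-1 ^+ i + D)%:E)%E.
Proof.
move=> D0 a11 vv1 sv1 IH /=.
have := measurable_trig_sublevel ((a1, v1) :: (a, v) :: s) (i + j).+1.
have : forall z, trig_sublevel ((a1, v1) :: (a, v) :: s) (i + j).+1 z ->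
  torus R n z /\ Normc.normc (trig ((a1, v1) :: (a, v) :: s) z) <= 2^-1 ^+ (i + j).+1.
  by [].
set E := trig_sublevel _ _; clearbody E => EP mE.
have Et : E `<=` torus R n by move=> z /EP[].
have v1v0 : v1 - v != 0 by rewrite subr_eq0 eq_sym.
rewrite -haar_selfcorrelation//.
have [bad [mbad bad_le badP]] : exists bad : set (n.-tuple R[i]), [/\
    measurable bad, (haar R n bad <= (2^-1 ^+ i)%:E)%E &
    forall w, ~ bad w ->
      torus R n w /\ 2^-1 ^+ i < Normc.normc (mono (v1 - v) w - 1)].
  have mt := measurableC (@measurable_torus R n).
  have mc := measurable_character_sublevel (v1 - v) i.
  exists (~` torus R n `|` character_sublevel (v1 - v) i); split.
  - exact: measurableU.
  - apply: le_trans (haar_character_sublevel i v1v0).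
    have h0 : haar R n (~` torus R n) = 0%E.
      rewrite probability_setC; last exact: measurable_torus.
      by rewrite haar_torus subee.
    by rewrite -[leRHS]add0e -h0; apply: measureU2.
  - move=> w /not_orP[/contrapT tw h]; split=> //.
    by rewrite ltNge; apply/negP => h'; apply: h.
apply: (@le_trans _ _ (\int[haar R n]_w ((\1_bad w)%:E + D%:E))%E); last first.
  rewrite ge0_integralD//; last exact/measurable_EFinP/measurable_indic.
  have -> : (\int[haar R n]__ D%:E = D%:E)%E.
    rewrite integral_cst// -[RHS]mule1; congr (_ * _)%E; exact: probability_setT.
  by rewrite integral_indic// setIT EFinD leeD2r.
apply: ge0_le_integral => //.
- rewrite (_ : (fun w => _) = haar R n \o xsection (selfcorrelation_set E)).
    by apply: measurable_fun_xsection; exact: measurable_selfcorrelation_set.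
  by apply/funext => w /=; rewrite xsection_selfcorrelation_set.
- by apply: emeasurable_funD => //; exact/measurable_EFinP/measurable_indic.
move=> w _; rewrite indicE.
have mEw : measurable (E `&` tmul w @^-1` E).
  apply: measurableI; first exact: mE.
  by apply: measurable_preimageT; [exact: measurable_tmul|exact: mE].
have [bw|bw] := boolP (w \in bad).
  by apply: le_trans (probability_le1 _ mEw) _; rewrite -EFinD lee_fin lerDl.
rewrite add0e.
have [tw big_w] : torus R n w /\ 2^-1 ^+ i < Normc.normc (mono (v1 - v) w - 1).
  by apply: badP; rewrite notin_setE in bw.
have n2 k : Normc.normc (2 ^+ k : R[i]) = 2 ^+ k by rewrite -natrX normc_natr natrX.
pose twist p : R[i] * 'rV[int]_n := (2 ^+ i * (p.1 * (mono p.2 w - mono v w)), p.2).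
have b1 : 1 <= Normc.normc (twist (a1, v1)).1.
  rewrite /= !Normc.normcM n2.
  have -> : mono v1 w - mono v w = mono v w * (mono (v1 - v) w - 1).
    by rewrite mulrBr mulr1 -monoD// (addrC v) subrK.
  rewrite Normc.normcM normc_mono// mul1r mulrCA -[leLHS]mulr1.
  apply: ler_pM => //.
  apply: le_trans (ler_wpM2l (exprn_ge0 i (ler0n R 2)) (ltW big_w)).
  by rewrite -exprMn divff// expr1n.
apply: le_trans (IH _ (map twist s) b1 _ _); last 2 first.
- by rewrite size_map.
- by move=> p /mapP[p' /sv1 p'v ->].
apply: le_measure; rewrite ?inE; first exact: mEw.
  exact: measurable_trig_sublevel.
move=> z [/EP[tz Qz] /EP[_ Qwz]]; split=> //.
have -> : trig (((twist (a1, v1)).1, v1) :: map twist s) z = 2 ^+ i *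
    (trig ((a1, v1) :: (a, v) :: s) (tmul w z) -
     mono v w * trig ((a1, v1) :: (a, v) :: s) z).
  rewrite trig_cons /twist trig_twist !trig_cons !mono_tmul /=.
  move: (trig _ _) (trig _ _) (mono _ _) (mono _ _) (mono _ _) (mono _ _).
  by move=> *; ring.
rewrite Normc.normcM n2.
have := normcB (trig ((a1, v1) :: (a, v) :: s) (tmul w z))
     (mono v w * trig ((a1, v1) :: (a, v) :: s) z).
rewrite Normc.normcM normc_mono// mul1r => h.
have {}h := le_trans h (lerD Qwz Qz).
have -> : 2^-1 ^+ j = 2 ^+ i * (2^-1 ^+ (i + j).+1 + 2^-1 ^+ (i + j).+1) :> R.
  have h2 : 2 ^+ i * 2^-1 ^+ i = 1 :> R by rewrite -exprMn divff// expr1n.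
  rewrite exprS exprD; move: (2 ^+ i) (2^-1 ^+ i) (2^-1 ^+ j) h2 => x y t xy.
  by transitivity (x * y * t); [rewrite xy mul1r|field].
by apply: ler_wpM2l => //; rewrite exprn_ge0.
Qed.

(** Induction on the number of terms besides a1 z^v1, starting from a monomial of
modulus at least 1. At level 2 i + 1 the step bounds the square of the measure
by 2^-i + C q^i, so the rate q is replaced by its fourth root. *)
Lemma trig_sublevel_bound (N : nat) : exists C q : R,
  [/\ 1 <= C, 2^-1 <= q, q < 1 &
   forall n (a1 : R[i]) (v1 : 'rV[int]_n) (s : seq (R[i] * 'rV[int]_n)),
     1 <= Normc.normc a1 -> size s = N -> {in s, forall p, p.2 != v1} ->
     forall j, (haar R n (trig_sublevel ((a1, v1) :: s) j) <= (C * q ^+ j)%:E)%E].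
Proof.
elim: N => [|N [C [q [C1 qhalf q1 IH]]]].
  exists 1, 2^-1; split=> //; first by rewrite invf_lt1 ?ltr1n.
  move=> n a1 v1 s a11 /size0nil -> _ [|j].
    by rewrite expr0 mulr1 probability_le1//; exact: measurable_trig_sublevel.
  rewrite (_ : trig_sublevel _ _ = set0) ?measure0.
    by rewrite lee_fin mul1r exprn_ge0.
  apply/seteqP; split=> // z [tz]; rewrite /trig big_cons big_nil addr0/=.
  rewrite Normc.normcM normc_mono// mulr1 => h.
  have : 2^-1 ^+ j.+1 < 1 :> R by rewrite exprn_ilt1// ?invr_ge0// invf_lt1 ?ltr1n.
  by move=> /(le_lt_trans (le_trans a11 h)); rewrite ltxx.
have q0 : 0 < q by apply: lt_le_trans qhalf; rewrite invr_gt0.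
pose r := Num.sqrt (Num.sqrt q).
have sq0 : 0 < Num.sqrt q by rewrite sqrtr_gt0.
have r0 : 0 < r by rewrite sqrtr_gt0.
have sq1 : Num.sqrt q < 1 by rewrite -sqrtr1 ltr_sqrt.
have r1 : r < 1 by rewrite -sqrtr1 ltr_sqrt.
have r2 : r ^+ 2 = Num.sqrt q by rewrite sqr_sqrtr// ltW.
have r4 : (r ^+ 2) ^+ 2 = q by rewrite r2 sqr_sqrtr// ltW.
have qr : q <= r.
  rewrite -r4 -exprM -[leRHS]expr1; apply: ler_wiXn2l => //; exact: ltW.
pose C' := Num.sqrt (1 + C) / r ^+ 2.
have C'1 : 1 <= C'.
  rewrite /C' ler_pdivlMr ?exprn_gt0// mul1r r2 ler_sqrt//; last lra.
  lra.
exists C', r; split=> //; first exact: le_trans qhalf qr.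
move=> n a1 v1 [//|[a v] s] a11 [sN] sv1 j.
have sv1' : {in s, forall p, p.2 != v1}.
  by move=> p ps; apply: sv1; rewrite inE ps orbT.
have vv1 : v != v1 by apply: (sv1 (a, v)); rewrite inE eqxx.
case: j => [|j].
  rewrite expr0 mulr1; apply: (@le_trans _ _ 1%E); last by rewrite lee_fin.
  exact: (probability_le1 _ (measurable_trig_sublevel _ _)).
pose i := j./2.
have ij : ((i + i).+1 <= j.+1)%N by rewrite ltnS addnn -[leqRHS]odd_double_half leq_addl.
have ji : (j.+1 <= (i + i).+2)%N.
  by rewrite ltnS -[leqLHS]odd_double_half addnn; case: odd; rewrite ?add1n ?add0n.
have D0 : 0 <= C * q ^+ i.
  by rewrite mulr_ge0//; [exact: le_trans C1|rewrite exprn_ge0// ltW].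
have := @trig_sublevel_step n a1 a v1 v s i i _ D0 a11 vv1 sv1' _.
move=> /(_ (fun b s' b1 ss sp => IH n b v1 s' b1 (etrans ss sN) sp i)).
move: (@subset_trig_sublevel n ((a1, v1) :: (a, v) :: s) _ _ ij).
have := measurable_trig_sublevel ((a1, v1) :: (a, v) :: s) (i + i).+1.
have := measurable_trig_sublevel ((a1, v1) :: (a, v) :: s) j.+1.
rewrite /=; set E := trig_sublevel _ j.+1.
set E' := trig_sublevel _ (i + i).+1; clearbody E E' => mE mE' EE' EE.
apply: (@le_trans _ _ (haar R n E')).
  by apply: (le_measure (haar R n)) EE'; rewrite inE.
move: EE.
have fE : haar R n E' \is a fin_num by exact: fin_num_measure.
have x0 : 0 <= fine (haar R n E') by exact: fine_ge0.
rewrite -(fineK fE) -EFinM !lee_fin.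
move: (fine _) x0 => x x0.
have qi : 2^-1 ^+ i <= q ^+ i by rewrite lerXn2r ?nnegrE// ltW.
move=> xx.
have qE : q ^+ i = (r ^+ (i + i)) ^+ 2.
  by rewrite -[in LHS]r4 -!exprM; congr (_ ^+ _); rewrite addnn -muln2 mulnC mulnA.
have {}xx : x ^+ 2 <= (Num.sqrt (1 + C) * r ^+ (i + i)) ^+ 2.
  rewrite exprMn sqr_sqrtr; last lra.
  rewrite expr2 (le_trans xx)// mulrDl mul1r -qE lerD//.
have ri0 : 0 <= r ^+ (i + i) by rewrite exprn_ge0// ltW.
have {}xx : x <= Num.sqrt (1 + C) * r ^+ (i + i).
  by rewrite -(@ler_pXn2r _ 2)// nnegrE mulr_ge0// sqrtr_ge0.
apply: le_trans xx _.
have -> : Num.sqrt (1 + C) * r ^+ (i + i) = C' * r ^+ (i + i).+2.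
  rewrite -addn2 [r ^+ (_ + 2)]exprD /C' [r ^+ (i + i) * _]mulrC mulrA divfK//.
  by rewrite gt_eqF// exprn_gt0.
apply: ler_wpM2l; first lra.
by apply: ler_wiXn2l => //; exact: ltW.
Qed.

End sublevel.

(** * Integrals of trigonometric polynomials *)

Section trig_integral.
Local Open Scope classical_set_scope.
Context {R : realType}.

Lemma normc_Re (x : R[i]) : `|complex.Re x| <= Normc.normc x.
Proof.
case: x => a b /=; rewrite -sqrtr_sqr; apply: ler_wsqrtr.
by rewrite lerDl sqr_ge0.
Qed.

Lemma normc_sum (I : Type) (r : seq I) (F : I -> R[i]) :
  Normc.normc (\sum_(i <- r) F i) <= \sum_(i <- r) Normc.normc (F i).
Proof.
elim: r => [|i r IH]; first by rewrite !big_nil Normc.normc0.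
by rewrite !big_cons (le_trans (normcD _ _))// lerD2l.
Qed.

Lemma normc_trig n (s : seq (R[i] * 'rV[int]_n)) z : torus R n z ->
  Normc.normc (trig s z) <= \sum_(p <- s) Normc.normc p.1.
Proof.
move=> tz; apply: le_trans (normc_sum _ _) _; apply: ler_sum => p _.
by rewrite Normc.normcM normc_mono// mulr1.
Qed.

Lemma integrable_Re_trig n (s : seq (R[i] * 'rV[int]_n)) :
  (haar R n).-integrable (torus R n) (fun z => (complex.Re (trig s z))%:E).
Proof.
apply: measurable_bounded_integrable.
- exact: measurable_torus.
- exact: le_lt_trans (probability_le1 (haar R n) (@measurable_torus R n)) (ltry 1).
- by apply: measurable_funTS; apply: measurable_funC_Re; exact: measurable_trig.
- exists (\sum_(p <- s) Normc.normc p.1); split; first exact: num_real.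
  move=> M /ltW sM z /= tz; apply: le_trans (normc_Re _) _.
  exact: le_trans (normc_trig _ tz) sM.
Qed.

Lemma integral_translation_odd n (u : n.-tuple R[i]) (f : n.-tuple R[i] -> \bar R) :
  torus R n u -> measurable_fun setT f ->
  (haar R n).-integrable (torus R n) f ->
  (forall z, f (tmul u z) = (- f z)%E) ->
  (\int[haar R n]_(z in torus R n) f z = 0)%E.
Proof.
move=> tu mf iI fN; have mt := @measurable_torus R n.
have tE : tmul u @^-1` torus R n = torus R n.
  by apply/seteqP; split=> z /(torus_tmul _ tu).
have fU : f \o tmul u = fun z => (- f z)%E by apply/funext => z; exact: fN.
have mu := measurable_tmul u.
have NI : (\int[haar R n]_(z in torus R n) f z =
    - \int[haar R n]_(z in torus R n) f z)%E.
  rewrite -integralN; last exact: integrable_add_def.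
  pose U : {mfun n.-tuple R[i] >-> n.-tuple R[i]} :=
    HB.pack (tmul u) (isMeasurableFun.Build _ _ _ _ _ mu).
  transitivity (\int[pushforward (haar R n) U]_(z in torus R n) f z)%E.
    by apply: eq_measure_integral => A mA _; apply/esym/haar_translation.
  have iU : (haar R n).-integrable (tmul u @^-1` torus R n) (f \o tmul u).
    by rewrite tE fU; exact: integrableN.
  have := integral_pushforward mu mf iU mt.
  by rewrite tE fU.
move: (integrable_fin_num mt iI) NI.
by case: (\int[_]_(z in _) f z)%E => // r _ [rN]; congr (_%:E); lra.
Qed.

(** Translating by u with u^v = -1 changes the sign of the integrand. *)
Lemma integral_Re_mono n (c : R[i]) (v : 'rV[int]_n) : v != 0 ->
  (\int[haar R n]_(z in torus R n) (complex.Re (c * mono v z))%:E = 0)%E.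
Proof.
move=> v0; have [u tu vu] := mono_eqN1 (R := R) v0.
have cE z : c * mono v z = trig [:: (c, v)] z by rewrite trig_cons trig_nil addr0.
apply: (integral_translation_odd tu).
- apply/measurable_EFinP; apply: measurable_funC_Re; apply: measurable_funCM.
    exact: measurable_cst.
  exact: measurable_mono.
- under eq_fun do rewrite cE.
  exact: integrable_Re_trig.
- move=> z; rewrite mono_tmul vu mulN1r mulrN -EFinN; congr (_%:E).
  by case: (c * mono v z).
Qed.

Lemma integral_Re_trig n (s : seq (R[i] * 'rV[int]_n)) :
  (\int[haar R n]_(z in torus R n) (complex.Re (trig s z))%:E =
   (complex.Re (\sum_(p <- s | p.2 == 0%R) p.1)%R)%:E)%E.
Proof.
have mt := @measurable_torus R n.
have ReD (x y : R[i]) : complex.Re (x + y) = complex.Re x + complex.Re y.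
  by case: x y => ? ? [].
elim: s => [|[c v] s IH].
  rewrite big_nil (eq_integral (cst 0%E)) ?integral_cst ?mul0e//.
  by move=> z _; rewrite trig_nil.
have cE z : trig ((c, v) :: s) z = trig [:: (c, v)] z + trig s z.
  by rewrite !trig_cons trig_nil addr0.
under eq_integral do rewrite cE ReD EFinD.
rewrite integralD//; try exact: integrable_Re_trig.
rewrite IH big_cons/=.
under eq_integral do rewrite trig_cons trig_nil addr0.
have [->|v0] := eqVneq v 0; last by rewrite integral_Re_mono// add0e.
under eq_integral do rewrite mono0 mulr1.
rewrite integral_cst// ReD EFinD; congr (_ + _)%E.
by rewrite -[RHS]mule1; congr (_ * _)%E; exact: haar_torus.
Qed.

End trig_integral.

(** * Monomial substitutions and the Boyd height *)

Section monomial_substitution.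
Local Open Scope classical_set_scope.
Context {R : realType}.

Definition torus_subst n m (A : 'M[int]_(n, m)) (z : m.-tuple R[i]) :
    n.-tuple R[i] :=
  [tuple \prod_(j < m) tnth z j ^ A i j | i < n].

Lemma torus_torus_subst n m (A : 'M[int]_(n, m)) z :
  torus R m z -> torus R n (torus_subst A z).
Proof.
move=> tz i; rewrite tnth_mktuple normc_prod big1// => j _.
by apply: normc_exprz; exact: tz.
Qed.

Lemma laurent_eval_trig n (P : laurent R n) z :
  laurent_eval P z = trig [seq (P@_v, v) | v <- msupp P] z.
Proof. by rewrite /trig big_map. Qed.

Lemma trig_torus_subst n m (A : 'M[int]_(n, m)) (s : seq (R[i] * 'rV[int]_n)) z :
  torus R m z ->
  trig s (torus_subst A z) = trig [seq (p.1, p.2 *m A) | p <- s] z.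
Proof.
move=> tz; rewrite /trig big_map; apply: eq_bigr => -[c v] _ /=; congr (_ * _).
rewrite /mono; under eq_bigr do rewrite tnth_mktuple.
transitivity (\prod_(j < m) \prod_(i < n) tnth z j ^ (v 0 i * A i j)).
  rewrite exchange_big; apply: eq_bigr => i _ /=.
  rewrite (@big_morph R[i] R[i] (fun x => x ^ v 0 i) 1 *%R 1 *%R
    (fun x y => expfzMl x y _) (exp1rz R[i] _)).
  by apply: eq_bigr => j _; rewrite mulrC exprz_exp.
apply: eq_bigr => j _; rewrite mxE.
by rewrite (@big_morph R[i] int (fun k => tnth z j ^ k) 1 *%R 0 +%R
  (fun k l => expfzDr k l (torus_neq0 j tz)) (expr0z _)).
Qed.

Lemma laurent_eval_torus_subst n m (P : laurent R n) (A : 'M[int]_(n, m)) z :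
  torus R m z ->
  laurent_eval (laurent_subst P A) z = laurent_eval P (torus_subst A z).
Proof. by move=> tz; apply: laurent_eval_subst => j; exact: torus_neq0. Qed.

Lemma boyd_height_kernel n m (A : 'M[int]_(n, m)) (M : R) (v : 'rV[int]_n) :
  (M%:E <= boyd_height R A)%E -> (supnorm v)%:R < M -> v *m A = 0 -> v = 0.
Proof.
move=> MA vM vA; apply/eqP; apply: contraTT vM => v0; rewrite -leNgt -lee_fin.
by apply: le_trans MA _; apply: ereal_inf_lbound; exists v.
Qed.

Lemma boyd_height_id n : boyd_height R (1%:M : 'M[int]_n) = +oo%E.
Proof.
rewrite /boyd_height (_ : [set _ | _ in _] = set0) ?ereal_inf0//.
apply/seteqP; split=> // x [v [/eqP v0]]; rewrite mulmx1 => vE.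
by case: v0.
Qed.

Lemma torus_subst_id n (z : n.-tuple R[i]) : torus_subst 1%:M z = z.
Proof.
apply: eq_from_tnth => i; rewrite tnth_mktuple (bigD1 i)//= mxE eqxx expr1z.
by rewrite big1 ?mulr1// => j ji; rewrite mxE eq_sym (negbTE ji) expr0z.
Qed.

(** Only values on the torus count: there the conjugate of z is z^-1, which makes
the class closed under conjugation. *)
Definition is_trig n (f : n.-tuple R[i] -> R[i]) :=
  exists s, forall z, torus R n z -> f z = trig s z.

Lemma is_trig_cst n (c : R[i]) : is_trig (fun _ : n.-tuple R[i] => c).
Proof. by exists [:: (c, 0)] => z _; rewrite trig_cons trig_nil mono0 mulr1 addr0. Qed.

Lemma trig_cat n (s1 s2 : seq (R[i] * 'rV[int]_n)) z :
  trig (s1 ++ s2) z = trig s1 z + trig s2 z.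
Proof. by rewrite /trig big_cat. Qed.

Lemma is_trigD n (f g : n.-tuple R[i] -> R[i]) :
  is_trig f -> is_trig g -> is_trig (fun z => f z + g z).
Proof.
move=> [s1 h1] [s2 h2]; exists (s1 ++ s2) => z tz.
by rewrite trig_cat h1// h2.
Qed.

Lemma trig_scale n (c : R[i]) (v : 'rV[int]_n) s z : torus R n z ->
  trig [seq (c * p.1, v + p.2) | p <- s] z = c * mono v z * trig s z.
Proof.
move=> tz; elim: s => [|[a u] s IH]; first by rewrite [map _ _]/= !trig_nil mulr0.
rewrite [map _ _]/= !trig_cons IH monoD//.
by move: (trig _ _) (mono _ _) (mono _ _) => *; ring.
Qed.

Lemma is_trigM n (f g : n.-tuple R[i] -> R[i]) :
  is_trig f -> is_trig g -> is_trig (fun z => f z * g z).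
Proof.
move=> [s1 h1] [s2 h2].
exists (flatten [seq [seq (p.1 * q.1, p.2 + q.2) | q <- s2] | p <- s1]) => z tz.
rewrite h1// h2//; elim: s1 {h1} => [|[a v] s1 IH].
  by rewrite [flatten _]/= !trig_nil mul0r.
by rewrite [flatten _]/= trig_cat -IH trig_scale// trig_cons mulrDl.
Qed.

Lemma conjc_mono n (v : 'rV[int]_n) (z : n.-tuple R[i]) : torus R n z ->
  (mono v z)^*%C = mono (- v) z.
Proof.
move=> tz; apply: (mulfI (mono_neq0 v tz)).
rewrite -monoD// subrr mono0 -sqr_normc.
have -> : `|mono v z| = (Normc.normc (mono v z))%:C%C by [].
by rewrite normc_mono// expr1n.
Qed.

Lemma is_trig_conjc n (f : n.-tuple R[i] -> R[i]) :
  is_trig f -> is_trig (fun z => (f z)^*%C).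
Proof.
move=> [s h]; exists [seq (p.1^*%C, - p.2) | p <- s] => z tz; rewrite h//.
elim: s {h} => [|[a v] s IH]; first by rewrite [map _ _]/= !trig_nil rmorph0.
by rewrite [map _ _]/= !trig_cons -IH rmorphD rmorphM /= conjc_mono.
Qed.

Definition is_real_trig n (f : n.-tuple R[i] -> R) :=
  is_trig (fun z => (f z)%:C%C).

Lemma is_real_trig_cst n (c : R) : is_real_trig (fun _ : n.-tuple R[i] => c).
Proof. exact: is_trig_cst. Qed.

Lemma is_real_trigD n (f g : n.-tuple R[i] -> R) :
  is_real_trig f -> is_real_trig g -> is_real_trig (fun z => f z + g z).
Proof.
move=> hf hg; have [s h] := is_trigD hf hg.
by exists s => z /h <-; rewrite rmorphD.
Qed.

Lemma is_real_trigM n (f g : n.-tuple R[i] -> R) :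
  is_real_trig f -> is_real_trig g -> is_real_trig (fun z => f z * g z).
Proof.
move=> hf hg; have [s h] := is_trigM hf hg.
by exists s => z /h <-; rewrite rmorphM.
Qed.

Lemma is_real_trigX n (f : n.-tuple R[i] -> R) k :
  is_real_trig f -> is_real_trig (fun z => f z ^+ k).
Proof.
move=> hf; elim: k => [|k IH].
  by under eq_fun do rewrite expr0; exact: is_real_trig_cst.
by under eq_fun do rewrite exprS; exact: is_real_trigM.
Qed.

Lemma is_real_trig_sum n (I : Type) (r : seq I) (F : I -> n.-tuple R[i] -> R) :
  (forall i, is_real_trig (F i)) -> is_real_trig (fun z => \sum_(i <- r) F i z).
Proof.
move=> hF; elim: r => [|i r IH].
  by under eq_fun do rewrite big_nil; exact: is_real_trig_cst.
by under eq_fun do rewrite big_cons; exact: is_real_trigD.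
Qed.

Lemma is_real_trig_prod n (I : Type) (r : seq I) (F : I -> n.-tuple R[i] -> R) :
  (forall i, is_real_trig (F i)) -> is_real_trig (fun z => \prod_(i <- r) F i z).
Proof.
move=> hF; elim: r => [|i r IH].
  by under eq_fun do rewrite big_nil; exact: is_real_trig_cst.
by under eq_fun do rewrite big_cons; exact: is_real_trigM.
Qed.

Lemma is_real_trig_normc_sqr n (P : laurent R n) :
  is_real_trig (fun z => Normc.normc (laurent_eval P z) ^+ 2).
Proof.
have hP : is_trig (laurent_eval P).
  by exists [seq (P@_v, v) | v <- msupp P] => z _; exact: laurent_eval_trig.
have [s h] := is_trigM hP (is_trig_conjc hP).
by exists s => z /h <-; rewrite rmorphXn/= -sqr_normc.
Qed.

Lemma integrable_real_trig_subst n m (A : 'M[int]_(n, m)) (f : n.-tuple R[i] -> R) :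
  is_real_trig f ->
  (haar R m).-integrable (torus R m) (fun z => (f (torus_subst A z))%:E).
Proof.
move=> [s h].
apply: (eq_integrable _ _ _ _ (integrable_Re_trig [seq (p.1, p.2 *m A) | p <- s])).
  exact: measurable_torus.
move=> z; rewrite inE => tz; rewrite -trig_torus_subst// -h//.
exact: torus_torus_subst.
Qed.

(** The integral picks the constant term, and p.2 *m A vanishes for no nonzero
exponent p.2 of f when the height of A exceeds all of them. *)
Lemma integral_real_trig_subst n (f : n.-tuple R[i] -> R) : is_real_trig f ->
  exists M : R, forall m (A : 'M[int]_(n, m)), (M%:E <= boyd_height R A)%E ->
    (\int[haar R m]_(z in torus R m) (f (torus_subst A z))%:E =
     \int[haar R n]_(z in torus R n) (f z)%:E)%E.
Proof.
move=> [s h]; exists ((\max_(p <- s) supnorm p.2).+1%:R) => m A MA.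
have -> : (\int[haar R n]_(z in torus R n) (f z)%:E =
    \int[haar R n]_(z in torus R n) (complex.Re (trig s z))%:E)%E.
  by apply: eq_integral => z; rewrite inE => tz; rewrite -h.
have -> : (\int[haar R m]_(z in torus R m) (f (torus_subst A z))%:E =
    \int[haar R m]_(z in torus R m)
      (complex.Re (trig [seq (p.1, p.2 *m A) | p <- s] z))%:E)%E.
  apply: eq_integral => z; rewrite inE => tz; rewrite -trig_torus_subst// -h//.
  exact: torus_torus_subst.
rewrite !integral_Re_trig big_map/=; congr ((complex.Re _)%:E).
rewrite big_seq_cond [RHS]big_seq_cond; apply: eq_bigl => p.
case ps: (p \in s) => //=; apply/eqP/eqP => [pA|->]; last exact: mul0mx.
apply: (boyd_height_kernel MA _ pA); rewrite ltr_nat ltnS.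
by apply: (@leq_bigmax_seq _ s xpredT (fun p => supnorm p.2)).
Qed.

End monomial_substitution.

(** * Polynomial approximation of the logarithm *)

Section logarithm_approximation.
Local Open Scope classical_set_scope.
Context {R : realType}.

(** The truncated expansion of ln at 1. *)
Definition ln_poly (L : nat) (u : R) : R :=
  \sum_(j < L) - ((1 - u) ^+ j.+1 / j.+1%:R).

Lemma is_derive_ln_poly L (x : R) :
  is_derive x 1 (ln_poly L) (\sum_(j < L) (1 - x) ^+ j).
Proof.
rewrite (_ : ln_poly L = \sum_(j < L) (fun u => - ((1 - u) ^+ j.+1 / j.+1%:R)));
    last by apply/funext => u; rewrite fct_sumE.
apply: is_derive_sum => j.
have h : is_derive x 1 (fun u : R => 1 - u) (0 - 1) by apply: is_deriveB.
have h2 := is_deriveN (is_deriveZ (j.+1%:R^-1) (is_deriveX j.+1 h)).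
rewrite (_ : (fun u => _) = - (j.+1%:R^-1 \*: (fun u : R => 1 - u) ^+ j.+1)).
  apply: is_derive_eq h2 _; rewrite /= sub0r /GRing.scale/= mulrN1 mulrN opprK.
  by rewrite mulrA mulVf ?mul1r// pnatr_eq0.
by apply/funext => u; rewrite !fctE /= /GRing.scale/= mulrC.
Qed.

(** ln_poly L - ln has derivative - (1 - t)^L / t and vanishes at 1. *)
Lemma ln_poly_MVT L (u : R) : 0 < u <= 1 ->
  exists2 t, u <= t <= 1 & ln_poly L u - ln u = (1 - t) ^+ L / t * (1 - u).
Proof.
move=> /andP[u0 u1].
pose df (t : R) := \sum_(j < L) (1 - t) ^+ j - t^-1.
pose g (t : R) : R := ln_poly L t - ln t.
have dh (t : R) : 0 < t -> is_derive t 1 g (df t).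
  by move=> t0; exact: is_deriveB (is_derive_ln_poly L t) (is_derive1_ln t0).
have dfE t : 0 < t -> df t = - ((1 - t) ^+ L / t).
  move=> t0; have tN0 : t != 0 by rewrite gt_eqF.
  apply: (mulfI tN0); rewrite mulrBr divff// mulrN mulrCA divff// mulr1.
  have := subrX1 (1 - t) L; rewrite [1 - t - 1](_ : _ = - t); last by ring.
  by rewrite mulNr => /(canRL (subrK _)) ->; rewrite opprD addrC; ring.
have [c ci E] : exists2 c, c \in `[u, 1]%R & g 1 - g u = df c * (1 - u).
  apply: (@MVT_segment R g df u 1 u1).
    by move=> t; rewrite in_itv/= => /andP[ut _]; apply: dh; exact: lt_trans ut.
  apply: derivable_within_continuous => t; rewrite in_itv/= => /andP[ut _].
  by have [] := dh t (lt_le_trans u0 ut).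
move: ci; rewrite in_itv => /= /andP[uc c1].
rewrite dfE ?(lt_le_trans u0)// in E; exists c; first exact/andP.
have h1 : g 1 = 0.
  rewrite /g ln1 subr0 /ln_poly big1// => j _.
  by rewrite subrr expr0n/= mul0r oppr0.
by move: E; rewrite h1 sub0r mulNr => /oppr_inj <-.
Qed.

Lemma ln_poly_ge L (u : R) : 0 < u <= 1 -> ln u <= ln_poly L u.
Proof.
move=> u01; have [t /andP[ut t1] E] := ln_poly_MVT L u01.
case/andP: u01 => u0 u1; have t0 := lt_le_trans u0 ut.
rewrite -subr_ge0 E mulr_ge0 ?subr_ge0// divr_ge0 ?exprn_ge0 ?subr_ge0//.
exact: ltW.
Qed.

Lemma ln_poly_le0 L (u : R) : 0 < u <= 1 -> ln_poly L u <= 0.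
Proof.
move=> /andP[u0 u1]; apply: sumr_le0 => j _.
by rewrite oppr_le0 divr_ge0// exprn_ge0// subr_ge0.
Qed.

Lemma ln_poly_approx (delta eps : R) : 0 < delta -> 0 < eps -> exists L,
  forall u, delta <= u <= 1 -> `|ln u - ln_poly L u| <= eps.
Proof.
move=> d0 e0.
have [d1|d1] := ltP 1 delta.
  by exists 0%N => u /andP[du u1]; have := lt_le_trans d1 (le_trans du u1); rewrite ltxx.
have q1 : `|1 - delta| < 1.
  by rewrite ger0_norm ?subr_ge0// ltrBlDr ltrDl.
have /cvgr_lt/(_ _ (mulr_gt0 e0 d0))[L _ /(_ L (leqnn L)) hL] := cvg_expr q1.
exists L => u /andP[du u1]; have u0 := lt_le_trans d0 du.
have u01 : 0 < u <= 1 by rewrite u0.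
rewrite distrC ger0_norm ?subr_ge0 ?ln_poly_ge//.
have [t /andP[ut t1] ->] := ln_poly_MVT L u01.
have t0 := lt_le_trans u0 ut; have dt := le_trans du ut.
apply: (@le_trans _ _ ((1 - t) ^+ L / t)).
  rewrite ler_piMr//; last by rewrite gerBl ltW.
  by rewrite divr_ge0 ?exprn_ge0 ?subr_ge0// ltW.
rewrite ler_pdivrMr//; apply: (@le_trans _ _ ((1 - delta) ^+ L)).
  by rewrite lerXn2r// ?nnegrE ?subr_ge0// lerD2l lerN2.
apply: le_trans (ltW hL) _; by rewrite ler_pM2l.
Qed.

(** With r the square root of q, the claim is (b + j)^k <= K r^-j, which follows
from the k-th power of x <= exp x at a small multiple x of b + j. *)
Lemma poly_geometric (b q : R) k : 0 <= b -> 0 < q < 1 ->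
  exists K r : R, [/\ 0 <= K, 0 < r < 1 &
    forall j : nat, (b + j%:R) ^+ k * q ^+ j <= K * r ^+ j].
Proof.
move=> b0 /andP[q0 q1].
pose r := Num.sqrt q.
have r0 : 0 < r by rewrite sqrtr_gt0.
have r1 : r < 1 by rewrite -sqrtr1 ltr_sqrt.
have rq : q = r * r by rewrite -expr2 sqr_sqrtr// ltW.
pose c := - ln r.
have c0 : 0 < c by rewrite oppr_gt0 ln_lt0// r0.
pose a := c / k.+1%:R.
have a0 : 0 < a by rewrite divr_gt0.
exists (a ^- k * expR (c * b)), r; split.
- by rewrite mulr_ge0 ?expR_ge0// invr_ge0 exprn_ge0// ltW.
- by rewrite r0.
move=> j; have bj0 : 0 <= b + j%:R by rewrite addr_ge0.
have h : (a * (b + j%:R)) ^+ k <= expR (c * b) * r ^- j.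
  apply: (@le_trans _ _ (expR (a * (b + j%:R)) ^+ k)).
    rewrite lerXn2r ?nnegrE ?expR_ge0//; first by rewrite mulr_ge0// ltW.
    by apply: le_trans (expR_ge1Dx _); rewrite lerDr.
  rewrite -expRM_natl -[r in leRHS]lnK ?posrE// -expRM_natl -expRN -expRD ler_expR.
  rewrite (_ : c * b + - (j%:R * ln r) = c * (b + j%:R)); last by rewrite /c; ring.
  rewrite mulrA ler_wpM2r// /a mulrCA ger_pMr// ler_pdivrMr// mul1r ler_nat.
  exact: leqnSn.
rewrite rq exprMn mulrA ler_pM2r ?exprn_gt0//.
move: h; rewrite exprMn ler_pdivlMr ?exprn_gt0//.
by rewrite -mulrA -ler_pdivlMl ?exprn_gt0.
Qed.

End logarithm_approximation.

(** * Integrals of functions bounded on layers *)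

Section layered_integral.
Local Open Scope classical_set_scope.
Context d (T : measurableType d) (R : realType).
Variable mu : probability T R.

(** On E (J + j) but off E (J + j + 1) the function is at most e (J + j), so on E J
it is dominated by the sum of the e (J + j) times the indicators of the
E (J + j). At a point of all the E (J + j) this sum is infinite because its
terms are at least 1. *)
Lemma layered_integral_le (D : set T) (E : nat -> set T) (G : T -> \bar R)
    (e c : nat -> R) (eps eps' : R) (J : nat) :
  measurable D -> (forall j, measurable (E j)) -> measurable_fun D G ->
  0 <= eps -> (forall j, 1 <= e j) -> (forall j, (mu (E j) <= (c j)%:E)%E) ->
  (forall z, D z -> ~ E J z -> (`|G z| <= eps%:E)%E) ->
  (forall z j, D z -> ~ E j.+1 z -> (`|G z| <= (e j)%:E)%E) ->
  (forall n, \sum_(j < n) e (J + j)%N * c (J + j)%N <= eps') ->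
  (\int[mu]_(z in D) `|G z| <= (eps + eps')%:E)%E.
Proof.
move=> mD mE mG eps0 e1 mu_le Geps Ge sum_le.
have e0 j : 0 <= e j by exact: le_trans (e1 j).
pose f j z : \bar R := ((e (J + j)%N)%:E * (\1_(E (J + j)%N) z)%:E)%E.
have f0 j z : (0 <= f j z)%E by rewrite mule_ge0 ?lee_fin.
have mf j : measurable_fun D (f j).
  apply: measurable_funeM; apply/measurable_EFinP; apply: measurable_funTS.
  exact: measurable_indic.
have fE j z : E (J + j)%N z -> f j z = (e (J + j)%N)%:E.
  by move=> Ez; rewrite /f indicE mem_set// mule1.
have pointwise z : D z -> (`|G z| <= eps%:E + \sum_(j <oo) f j z)%E.
  move=> Dz; have S0 : (0 <= \sum_(j <oo) f j z)%E by apply: nneseries_ge0.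
  have part n : (\sum_(0 <= j < n) f j z <= \sum_(j <oo) f j z)%E.
    by apply: nneseries_lim_ge.
  have [EJ|EJ] := pselect (E J z); last first.
    by apply: le_trans (Geps z Dz EJ) _; rewrite leeDl.
  have [[j nE]|allE] := pselect (exists j, ~ E (J + j)%N z).
    have exj : exists j, `[< ~ E (J + j)%N z >] by exists j; exact/asboolP.
    case: (ex_minnP exj) => -[|m] /asboolP nEm minm; first by rewrite addn0 in nEm.
    have Em : E (J + m)%N z.
      by apply: contrapT => /asboolP/minm; rewrite ltnn.
    rewrite addnS in nEm.
    apply: le_trans (Ge z _ Dz nEm) _; rewrite -(fE m z)//.
    apply: (@le_trans _ _ (\sum_(0 <= j < m.+1) f j z)%E).
      by rewrite big_nat_recr//= leeDr// sume_ge0.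
    by apply: le_trans (part _) _; rewrite leeDr// lee_fin.
  rewrite (_ : (\sum_(j <oo) f j z)%E = +oo%E) ?addey ?leey//.
  apply/eqyP => A A0; apply: le_trans (part (Num.bound A)).
  apply: (@le_trans _ _ (\sum_(0 <= j < Num.bound A) 1%:E)%E).
    rewrite sumEFin lee_fin sumr_const_nat subn0.
    exact: ltW (archi_boundP (ltW A0)).
  apply: lee_sum => j _; rewrite fE ?lee_fin//.
  by apply: contrapT => h; apply: allE; exists j.
apply: (@le_trans _ _ (\int[mu]_(z in D) (eps%:E + \sum_(j <oo) f j z))%E).
  apply: ge0_le_integral => //.
  - exact: measurableT_comp.
  - apply: emeasurable_funD => //; apply: ge0_emeasurable_sum => //.
have mS : measurable_fun D (fun z => \sum_(j <oo) f j z)%E.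
  by apply: ge0_emeasurable_sum.
rewrite ge0_integralD//; last by move=> z _; apply: nneseries_ge0.
rewrite EFinD leeD//.
  rewrite integral_cst// -[leRHS]mule1; apply: lee_pmul => //.
  exact: probability_le1.
rewrite integral_nneseries//.
apply: lime_le; first by apply: is_cvg_nneseries => j _ _; exact: integral_ge0.
apply: nearW => n; rewrite big_mkord.
apply: (@le_trans _ _ (\sum_(j < n) (e (J + j)%N * c (J + j)%N)%:E)%E); last first.
  by rewrite sumEFin lee_fin.
apply: lee_sum => j _; rewrite ge0_integralZl ?lee_fin//; last first.
  by apply/measurable_EFinP; apply: measurable_funTS; exact: measurable_indic.
rewrite integral_indic// EFinM lee_pmul ?lee_fin//.
apply: le_trans (mu_le _); apply: le_measure; rewrite ?inE//.
exact: measurableI.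
Qed.

End layered_integral.

(** * The maximum and the product of logarithms *)

Section log_approximable.
Local Open Scope classical_set_scope.
Context {R : realType} (k n : nat) (X : 'I_k -> n.-tuple R[i] -> R) (B : R).
Hypothesis X_trig : forall i, is_real_trig (fun z => X i z ^+ 2).
Hypothesis B1 : 1 <= B.

(** F is approximated by functions p that become trigonometric polynomials when
the X i are substituted for the coordinates. The approximation is uniform away
from the coordinate hyperplanes, and its error grows at most like a power of
the logarithm of the distance to them, with b and r independent of eps. *)
Definition log_approximable (F : ('I_k -> R) -> \bar R) :=
  exists (b : R) (r : nat), 1 <= b /\ forall (J : nat) (eps : R), 0 < eps ->
    exists2 p, is_real_trig (fun z => p (X^~ z)) &
      forall x : 'I_k -> R, (forall i, x i <= B) ->
      (forall j : nat, (forall i, 2^-1 ^+ j.+1 < x i) ->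
         (`|F x - (p x)%:E| <= (2 * (b + j%:R) ^+ r)%:E)%E) /\
      ((forall i, 2^-1 ^+ J < x i) -> (`|F x - (p x)%:E| <= eps%:E)%E).

Let B0 : 0 < B. Proof. exact: lt_le_trans B1. Qed.
Let lnB0 : 0 <= ln B. Proof. exact: ln_ge0. Qed.

Lemma half_exp_gt0 j : 0 < 2^-1 ^+ j :> R.
Proof. by rewrite exprn_gt0// invr_gt0. Qed.

Lemma is_real_trig_ln_poly L (f : n.-tuple R[i] -> R) :
  is_real_trig f -> is_real_trig (fun z => ln_poly L (f z)).
Proof.
move=> hf; apply: is_real_trig_sum => j.
rewrite (_ : (fun z => _) = fun z => - j.+1%:R^-1 * (1 + (- 1) * f z) ^+ j.+1).
  apply: is_real_trigM; first exact: is_real_trig_cst.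
  apply: is_real_trigX; apply: is_real_trigD; first exact: is_real_trig_cst.
  by apply: is_real_trigM => //; exact: is_real_trig_cst.
by apply/funext => z; rewrite !mulNr mul1r mulrC.
Qed.

Lemma is_real_trigZ (c : R) (f : n.-tuple R[i] -> R) :
  is_real_trig f -> is_real_trig (fun z => c * f z).
Proof. by apply: is_real_trigM; exact: is_real_trig_cst. Qed.

Lemma ln_lower j (x : R) : 2^-1 ^+ j.+1 < x -> - j.+1%:R <= ln x.
Proof.
move=> jx; have x0 : 0 < x by exact: lt_trans (half_exp_gt0 _) jx.
apply: (@le_trans _ _ (ln (2^-1 ^+ j.+1))); last first.
  by rewrite ler_ln ?posrE ?half_exp_gt0// ltW.
rewrite lnXn ?invr_gt0// lnV ?posrE// mulNrn lerN2 lerMn2r/=.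
by have := @le_ln1Dx R 1; rewrite -[1 + 1]/(2%:R); apply; lra.
Qed.

Lemma ln_upper (x : R) : 0 < x -> x <= B -> ln x <= ln B.
Proof. by move=> x0 xB; rewrite ler_ln ?posrE. Qed.

(** A coordinate in ]0, B] is brought to ]0, 1], where ln_poly approximates ln, and
squared, as only the squared moduli are trigonometric polynomials. *)
Definition unit_sqr (x : R) : R := x ^+ 2 / B ^+ 2.

Lemma unit_sqr_in (x : R) : 0 < x -> x <= B -> 0 < unit_sqr x <= 1.
Proof.
move=> x0 xB; rewrite divr_gt0 ?exprn_gt0//= ler_pdivrMr ?exprn_gt0// mul1r.
by apply: lerXn2r => //; rewrite nnegrE ltW.
Qed.

Lemma ln_unit_sqr (x : R) : 0 < x -> ln x = ln B + 2^-1 * ln (unit_sqr x).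
Proof.
move=> x0; rewrite /unit_sqr ln_div ?posrE ?exprn_gt0// !lnXn//; by field.
Qed.

Lemma is_real_trig_unit_sqr i : is_real_trig (fun z => unit_sqr (X i z)).
Proof.
rewrite (_ : (fun z => _) = fun z => (B ^+ 2)^-1 * X i z ^+ 2).
  exact: is_real_trigZ.
by apply/funext => z; rewrite mulrC.
Qed.

Lemma le_unit_sqr (d x : R) : 0 < d -> d < x -> unit_sqr d <= unit_sqr x.
Proof.
move=> d0 dx; rewrite /unit_sqr ler_pM2r ?invr_gt0 ?exprn_gt0//.
by apply: lerXn2r; rewrite ?nnegrE ltW// (lt_trans d0).
Qed.

Lemma normr_prod_le (I : Type) (s : seq I) (f : I -> R) (b : R) :
  (forall i, `|f i| <= b) -> `|\prod_(i <- s) f i| <= b ^+ size s.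
Proof.
move=> fb; elim: s => [|i s IH]; first by rewrite big_nil normr1 expr0.
by rewrite big_cons normrM exprS ler_pM.
Qed.

Lemma normr_prodB_le (I : Type) (s : seq I) (f g : I -> R) (b e : R) :
  1 <= b -> 0 <= e -> (forall i, `|f i| <= b) -> (forall i, `|g i| <= b) ->
  (forall i, `|f i - g i| <= e) ->
  `|\prod_(i <- s) f i - \prod_(i <- s) g i| <= (size s)%:R * b ^+ size s * e.
Proof.
move=> b1 e0 fb gb fg; have b0 : 0 <= b by exact: le_trans b1.
elim: s => [|i s IH]; first by rewrite !big_nil subrr normr0 !mul0r.
rewrite !big_cons.
rewrite (_ : f i * _ - _ = f i * (\prod_(j <- s) f j - \prod_(j <- s) g j) +
    (f i - g i) * \prod_(j <- s) g j); last by ring.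
apply: le_trans (ler_normD _ _) _; rewrite !normrM /=.
have h1 := ler_pM (normr_ge0 _) (normr_ge0 _) (fb i) IH.
have h2 := ler_pM (normr_ge0 _) (normr_ge0 _) (fg i) (normr_prod_le s gb).
apply: le_trans (lerD h1 h2) _.
have h3 : e * b ^+ size s <= b ^+ (size s).+1 * e.
  by rewrite exprS mulrC ler_wpM2r// ler_peMl// exprn_ge0.
apply: le_trans (lerD (lexx _) h3) _.
by rewrite -(natr1 (size s)) exprS le_eqVlt; apply/orP; left; apply/eqP; ring.
Qed.

(** ln x is replaced by c x, half the truncated expansion at the normalized square
plus ln B. As c x lies between ln x and ln B, it obeys the same bounds. *)
Lemma log_approximable_prod :
  log_approximable (fun x => (\prod_(i < k) lne (x i)%:E)%E).
Proof.
exists (ln B + 1), k; split; first by rewrite lerDr.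
move=> J eps eps0.
pose d := unit_sqr (2^-1 ^+ J).
have d0 : 0 < d by rewrite /d divr_gt0// ?exprn_gt0// invr_gt0.
pose bJ := ln B + 1 + J%:R.
have bJ1 : 1 <= bJ by rewrite /bJ -addrA addrCA lerDl addr_ge0.
pose e := eps / (k.+1%:R * bJ ^+ k).
have bJk0 : 0 < bJ ^+ k by rewrite exprn_gt0// (lt_le_trans _ bJ1).
have e0 : 0 < e by rewrite divr_gt0// mulr_gt0.
have [L hL] := ln_poly_approx d0 e0.
pose c (x : R) := 2^-1 * ln_poly L (unit_sqr x) + ln B.
exists (fun x => \prod_(i < k) c (x i)).
  apply: is_real_trig_prod => i; apply: is_real_trigD; last exact: is_real_trig_cst.
  by apply: is_real_trigZ; apply: is_real_trig_ln_poly; exact: is_real_trig_unit_sqr.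
move=> x xB.
have FE j : (forall i, 2^-1 ^+ j < x i) ->
    (\prod_(i < k) lne (x i)%:E)%E = (\prod_(i < k) ln (x i))%:E.
  move=> jx; rewrite -prodEFin; apply: eq_bigr => i _; rewrite lne_EFin//.
  exact: lt_trans (half_exp_gt0 j) (jx i).
have bounds j i : 2^-1 ^+ j.+1 < x i ->
    `|ln (x i)| <= ln B + 1 + j%:R /\ `|c (x i)| <= ln B + 1 + j%:R.
  move=> jx; have x0 := lt_trans (half_exp_gt0 _) jx.
  have u01 := unit_sqr_in x0 (xB i).
  have := ln_poly_ge L u01; have := ln_poly_le0 L u01.
  have := ln_upper x0 (xB i); have := ln_lower jx; have := ln_unit_sqr x0.
  rewrite /c -(natr1 j); have := lnB0; have : 0 <= j%:R :> R by [].
  move: (ln_poly _ _) (ln (unit_sqr _)) (ln (x i)) (ln B) (j%:R) => t u y l jj.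
  by move=> *; split; rewrite ler_norml; apply/andP; split; lra.
split=> [j jx|Jx]; rewrite (FE _ ltac:(eassumption)) -EFinB abse_EFin lee_fin.
  apply: le_trans (ler_normB _ _) _.
  have hf := @normr_prod_le _ (index_enum 'I_k) (fun i => ln (x i)) _
    (fun i => (bounds j i (jx i)).1).
  have hg := @normr_prod_le _ (index_enum 'I_k) (fun i => c (x i)) _
    (fun i => (bounds j i (jx i)).2).
  move: hf hg; rewrite /index_enum -enumT size_enum_ord => hf hg.
  by rewrite mulr_natl mulr2n lerD.
have Jx' i : 2^-1 ^+ J.+1 < x i.
  apply: le_lt_trans (Jx i); rewrite exprS ger_pMl ?half_exp_gt0//; lra.
have fg i : `|ln (x i) - c (x i)| <= e.
  have x0 := lt_trans (half_exp_gt0 _) (Jx i).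
  have u01 := unit_sqr_in x0 (xB i).
  have := hL (unit_sqr (x i)); rewrite le_unit_sqr ?half_exp_gt0//=.
  case/andP: u01 => _ -> => /(_ isT).
  rewrite /c (ln_unit_sqr x0) => h.
  rewrite (_ : _ - _ = 2^-1 * (ln (unit_sqr (x i)) - ln_poly L (unit_sqr (x i)))); last by ring.
  rewrite normrM gtr0_norm ?invr_gt0//; move: h; move: (`| _ |) => y; have := e0; lra.
have := @normr_prodB_le _ (index_enum 'I_k) (fun i => ln (x i)) (fun i => c (x i)) _ _ bJ1 (ltW e0)
  (fun i => (bounds J i (Jx' i)).1) (fun i => (bounds J i (Jx' i)).2) fg.
rewrite /index_enum -enumT size_enum_ord => h; apply: le_trans h _.
rewrite /e mulrA ler_pdivrMr ?mulr_gt0// [leRHS]mulrC ler_pM2r// ler_wpM2r ?(ltW bJk0)//.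
by rewrite ler_nat leqnSn.
Qed.

(** With S the mean of the N-th powers of the normalized squares,
ln S / (2 N) + ln B differs by at most ln k / (2 N) from the largest ln (x i),
and S, unlike the maximum, is a polynomial in the squares. *)
Lemma log_approximable_max : (0 < k)%N ->
  log_approximable (fun x => (\big[maxe/-oo]_(i < k) lne (x i)%:E)%E).
Proof.
move=> k0; have k1 : 1 <= k%:R :> R by rewrite ler1n.
have kp : 0 < k%:R :> R by rewrite ltr0n.
have lnk0 : 0 <= ln k%:R :> R by exact: ln_ge0.
exists (ln B + 1 + ln k%:R), 1%N; split; first by rewrite -addrA addrCA lerDl addr_ge0.
move=> J eps eps0.
have [N0 hN0] : exists N0 : nat, ln k%:R / eps <= N0%:R.
  exists (Num.bound (ln k%:R / eps)); apply/ltW/archi_boundP.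
  by rewrite divr_ge0// ltW.
pose N := N0.+1; have Np : 0 < N%:R :> R by rewrite ltr0n.
have hN : ln k%:R <= N%:R * eps.
  rewrite -ler_pdivrMr//; apply: le_trans hN0 _; by rewrite ler_nat leqnSn.
pose d := unit_sqr (2^-1 ^+ J) ^+ N.
have d0 : 0 < d by rewrite /d exprn_gt0// divr_gt0// ?exprn_gt0// invr_gt0.
have [L hL] := ln_poly_approx d0 eps0.
pose S (x : 'I_k -> R) := k%:R^-1 * \sum_(i < k) unit_sqr (x i) ^+ N.
exists (fun x => (2 * N%:R)^-1 * ln_poly L (S x) + ln B).
  apply: is_real_trigD; last exact: is_real_trig_cst.
  apply: is_real_trigZ; apply: is_real_trig_ln_poly; apply: is_real_trigZ.
  by apply: is_real_trig_sum => i; apply: is_real_trigX; exact: is_real_trig_unit_sqr.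
move=> x xB.
have key j : (forall i, 2^-1 ^+ j < x i) -> exists i0 : 'I_k, [/\
    (\big[maxe/-oo]_(i < k) lne (x i)%:E)%E = (ln (x i0))%:E,
    0 < S x <= 1, ln (S x) <= N%:R * ln (unit_sqr (x i0)) &
    N%:R * ln (unit_sqr (x i0)) <= ln (S x) + ln k%:R].
  move=> jx; have x0 i := lt_trans (half_exp_gt0 j) (jx i).
  have [i0 _ i0E] := @eq_bigmax _ _ _ -oo%E (Ordinal k0) xpredT
    (fun i => lne (x i)%:E) isT (fun _ _ => leNye _).
  have xi0 i : x i <= x i0.
    have : (lne (x i)%:E <= lne (x i0)%:E)%E.
      by rewrite -i0E; exact: (le_bigmax _ (fun i => lne (x i)%:E)).
    by rewrite !lne_EFin// lee_fin ler_ln ?posrE.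
  have u0 i : 0 < unit_sqr (x i) by have /andP[] := unit_sqr_in (x0 i) (xB i).
  have u1 i : unit_sqr (x i) <= 1 by have /andP[] := unit_sqr_in (x0 i) (xB i).
  have uN0 i : 0 < unit_sqr (x i) ^+ N by rewrite exprn_gt0.
  have ui0 i : unit_sqr (x i) ^+ N <= unit_sqr (x i0) ^+ N.
    apply: lerXn2r; rewrite ?nnegrE ?(ltW (u0 _))//.
    rewrite /unit_sqr ler_pM2r ?invr_gt0 ?exprn_gt0//.
    by apply: lerXn2r; rewrite ?nnegrE// ltW.
  have S_ge : unit_sqr (x i0) ^+ N <= k%:R * S x.
    rewrite /S mulrA divff ?gt_eqF// mul1r (bigD1 i0)//= lerDl.
    by apply: sumr_ge0 => i _; exact: ltW.
  have S_le : S x <= unit_sqr (x i0) ^+ N.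
    rewrite /S mulrC ler_pdivrMr// mulr_natr -[in leRHS](card_ord k) -sumr_const.
    exact: ler_sum.
  have S0 : 0 < S x.
    by rewrite -(pmulr_rgt0 _ kp); exact: lt_le_trans S_ge.
  have S1 : S x <= 1.
    by apply: le_trans S_le _; rewrite exprn_ile1// ltW.
  exists i0; split; rewrite ?S0//.
  - by rewrite i0E lne_EFin.
  - by rewrite mulr_natl -lnXn// ler_ln ?posrE.
  - rewrite mulr_natl -lnXn// addrC -lnM ?posrE// ler_ln ?posrE//.
    by rewrite mulr_gt0.
have N1 : 1 <= N%:R :> R by rewrite ler1n.
split=> [j jx|Jx].
  have [i0 [-> S01 S_le S_ge]] := key _ jx.
  have x0 := lt_trans (half_exp_gt0 _) (jx i0).
  have := ln_poly_ge L S01; have := ln_poly_le0 L S01.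
  have := ln_upper x0 (xB i0); have := ln_lower (jx i0); have := ln_unit_sqr x0.
  have : 0 <= j%:R :> R by [].
  rewrite -EFinB abse_EFin lee_fin expr1 -(natr1 j) invfM.
  set a := N%:R^-1.
  have a1 : 0 < a <= 1 by rewrite invr_gt0 Np invf_le1.
  have aN : a * N%:R = 1 by rewrite mulVf// gt_eqF.
  case/andP: a1 => a0 a1.
  have := ler_wpM2l (ltW a0) S_le; rewrite mulrA aN mul1r => aS.
  have := ler_wpM2l (ltW a0) S_ge; rewrite mulrA aN mul1r mulrDr => aS'.
  move=> j0 xE x_lower x_upper T0 TS.
  have aT0 : a * ln_poly L (S x) <= 0 by rewrite pmulr_rle0.
  have aTS : a * ln (S x) <= a * ln_poly L (S x) by rewrite ler_pM2l.
  have alnk : a * ln k%:R <= ln k%:R by exact: ler_piMl.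
  rewrite -mulrA.
  move: (a * ln (S x)) (a * ln_poly L (S x)) (a * ln k%:R) aS aS' aT0 aTS alnk
    => s t l' *.
  by rewrite ler_norml; apply/andP; split; lra.
have [i0 [-> S01 S_le S_ge]] := key _ Jx.
have x0 := lt_trans (half_exp_gt0 _) (Jx i0).
have dS : d <= S x.
  rewrite /S mulrC ler_pdivlMr// mulr_natr -[in leLHS](card_ord k) -sumr_const.
  apply: ler_sum => i _; apply: lerXn2r; rewrite ?nnegrE.
  - by rewrite ltW// divr_gt0// ?exprn_gt0// invr_gt0.
  - by have /andP[/ltW] := unit_sqr_in (lt_trans (half_exp_gt0 _) (Jx i)) (xB i).
  - exact: le_unit_sqr (half_exp_gt0 J) (Jx i).
have hT := hL (S x); rewrite dS /= in hT; case/andP: (S01) => _ S1.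
have {}hT := hT S1.
rewrite -EFinB abse_EFin lee_fin (ln_unit_sqr x0) invfM.
set a := N%:R^-1.
have a0 : 0 < a by rewrite invr_gt0.
have a1 : a <= 1 by rewrite invf_le1.
have aN : a * N%:R = 1 by rewrite mulVf// gt_eqF.
have := ler_wpM2l (ltW a0) S_le; rewrite mulrA aN mul1r => aS.
have := ler_wpM2l (ltW a0) S_ge; rewrite mulrA aN mul1r mulrDr => aS'.
have alnk : a * ln k%:R <= eps.
  by have := ler_wpM2l (ltW a0) hN; rewrite mulrA aN mul1r.
have aT : `|a * ln (S x) - a * ln_poly L (S x)| <= eps.
  rewrite -mulrBr normrM gtr0_norm//; apply: le_trans hT.
  by rewrite ler_piMl.
rewrite -mulrA.
move: (a * ln (S x)) (a * ln_poly L (S x)) (a * ln k%:R) aS aS' aT alnk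
  => s t l' aS aS'.
rewrite !ler_norml => /andP[h1 h2] h3; apply/andP; split; lra.
Qed.

End log_approximable.

(** * Sublevel sets of Laurent polynomials *)

Section laurent_sublevel.
Local Open Scope classical_set_scope.
Context {R : realType}.

Lemma measurable_torus_subst n m (A : 'M[int]_(n, m)) :
  measurable_fun setT (torus_subst A : m.-tuple R[i] -> n.-tuple R[i]).
Proof.
apply/measurable_fun_tnthP => i.
rewrite (_ : _ \o _ = fun z => \prod_(j < m) tnth z j ^ A i j).
  apply: measurable_funC_prod => j; apply: measurable_funCXz.
  exact: measurable_tnthC.
by apply/funext => z /=; rewrite tnth_mktuple.
Qed.

Lemma measurable_laurent_eval_subst n m (P : laurent R n) (A : 'M[int]_(n, m)) :
  measurable_fun setT (fun z : m.-tuple R[i] => laurent_eval P (torus_subst A z)).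
Proof.
apply: (measurableT_comp _ (measurable_torus_subst A)).
rewrite (_ : laurent_eval P = trig [seq (P@_v, v) | v <- msupp P]).
  exact: measurable_trig.
by apply/funext => z; exact: laurent_eval_trig.
Qed.

Definition laurent_sublevel n m (P : laurent R n) (A : 'M[int]_(n, m)) (j : nat) :
    set (m.-tuple R[i]) :=
  [set z | torus R m z /\
    Normc.normc (laurent_eval P (torus_subst A z)) <= 2^-1 ^+ j].

Lemma measurable_laurent_sublevel n m (P : laurent R n) (A : 'M[int]_(n, m)) j :
  measurable (laurent_sublevel P A j).
Proof. by apply: measurable_normc_le; exact: measurable_laurent_eval_subst. Qed.

(** For A of large height the exponents v *m A stay apart from v1 *m A, so the
coefficient at v1 serves as the distinguished one of the composition. *)
Lemma laurent_sublevel_bound n (P : laurent R n) : P != 0 ->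
  exists C q M : R, [/\ 0 <= C, 0 < q < 1 &
    forall m (A : 'M[int]_(n, m)), (M%:E <= boyd_height R A)%E -> forall j,
      (haar R m (laurent_sublevel P A j) <= (C * q ^+ j)%:E)%E].
Proof.
move=> P0.
have [v1 v1P] : exists v1, v1 \in msupp P.
  apply: contrapT => nP; move/negP: P0; apply; apply/eqP/malgP => v.
  by rewrite mcoeff0 mcoeff_outdom//; apply/negP => vP; apply: nP; exists v.
have a0 : 0 < Normc.normc P@_v1.
  rewrite lt_neqAle normc_ge0 andbT eq_sym; apply: contraTneq v1P => /Normc.eq0_normc.
  by move=> Pv; rewrite -mcoeff_neq0 Pv eqxx.
pose rest := [seq v <- msupp P | v != v1].
have [C [q [C1 qhalf q1 bound]]] := trig_sublevel_bound (R := R) (size rest).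
have q0 : 0 < q by apply: lt_le_trans qhalf; rewrite invr_gt0.
(* The distinguished coefficient is scaled by 2^i0 to modulus at least 1, which
   shifts the levels by i0. *)
pose i0 := Num.bound (Normc.normc P@_v1)^-1.
have i0P : 1 <= 2 ^+ i0 * Normc.normc P@_v1.
  rewrite -ler_pdivrMr// mul1r; apply: ltW; apply: lt_le_trans (archi_boundP _) _.
    by rewrite invr_ge0 ltW.
  by rewrite -/i0 -natrX ler_nat ltnW// ltn_expl.
have qi0 : 0 < q ^+ i0 by rewrite exprn_gt0.
exists (C / q ^+ i0), q, ((\max_(v <- msupp P) supnorm (v - v1)).+1%:R).
split; [|by rewrite q0|].
  by rewrite divr_ge0 ?(ltW qi0)//; exact: le_trans C1.
move=> m A MA j.
have [ji|ij] := ltnP j i0.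
  apply: le_trans (probability_le1 _ (measurable_laurent_sublevel P A j)) _.
  rewrite lee_fin mulrAC ler_pdivlMr// mul1r.
  apply: (@le_trans _ _ (q ^+ j)); first by apply: ler_wiXn2l; rewrite ?(ltnW ji)// ltW.
  by apply: ler_peMl => //; rewrite exprn_ge0// ltW.
pose s := [seq (2 ^+ i0 * P@_v, v *m A) | v <- rest].
have sP : {in s, forall p, p.2 != v1 *m A}.
  move=> p /mapP[v]; rewrite mem_filter => /andP[vv1 vP] -> /=.
  apply: contra vv1 => /eqP vA; rewrite -subr_eq0; apply/eqP.
  apply: (boyd_height_kernel MA); last by rewrite mulmxBl vA subrr.
  rewrite ltr_nat ltnS.
  by apply: (@leq_bigmax_seq _ (enum_fset (msupp P)) xpredT (fun v => supnorm (v - v1))).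
have n2 k : Normc.normc (2 ^+ k : R[i]) = 2 ^+ k by rewrite -natrX normc_natr natrX.
have a1 : 1 <= Normc.normc (2 ^+ i0 * P@_v1) by rewrite Normc.normcM n2.
have := bound m (2 ^+ i0 * P@_v1) (v1 *m A) s a1 _ sP (j - i0)%N.
rewrite size_map => /(_ erefl) h.
rewrite mulrAC -mulrA -exprB ?unitfE ?gt_eqF//.
apply: le_trans h; apply: le_measure; rewrite ?inE.
- exact: measurable_laurent_sublevel.
- exact: measurable_trig_sublevel.
move=> z [tz Pz]; split=> //.
have -> : trig ((2 ^+ i0 * P@_v1, v1 *m A) :: s) z =
    2 ^+ i0 * laurent_eval P (torus_subst A z).
  rewrite laurent_eval_trig trig_torus_subst// trig_cons /trig !big_map.
  rewrite [in RHS](bigD1_seq v1) ?fset_uniq//= mulrDr mulrA; congr (_ + _).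
  by rewrite big_filter big_distrr; apply: eq_bigr => v _; rewrite /= mulrA.
rewrite Normc.normcM n2 (_ : 2^-1 ^+ (j - i0) = 2 ^+ i0 * 2^-1 ^+ j :> R).
  by rewrite ler_wpM2l// exprn_ge0.
by rewrite -{2}(subnKC ij) exprD mulrA -exprMn divff// expr1n mul1r.
Qed.

(** If the composition vanished, all its sublevel sets would be the whole torus. *)
Lemma laurent_subst_neq0 n (P : laurent R n) : P != 0 ->
  exists M : R, forall m (A : 'M[int]_(n, m)), (M%:E <= boyd_height R A)%E ->
    laurent_subst P A != 0.
Proof.
move=> /laurent_sublevel_bound[C [q [M [C0 /andP[q0 q1] bound]]]].
exists M => m A MA; apply/eqP => PA0.
have C10 : 0 < (C + 1)^-1 by rewrite invr_gt0; lra.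
have q1' : `|q| < 1 by rewrite gtr0_norm.
have /cvgr_lt/(_ _ C10)[j _ /(_ j (leqnn j)) hj] := cvg_expr q1'.
have := bound m A MA j.
have -> : laurent_sublevel P A j = torus R m.
  apply/seteqP; split=> z; first by case.
  move=> tz; split=> //; rewrite -laurent_eval_torus_subst// PA0 /laurent_eval msupp0.
  by rewrite big_seq_fset0 Normc.normc0 exprn_ge0.
rewrite haar_torus lee_fin => h.
have : C * q ^+ j < 1.
  apply: (@le_lt_trans _ _ (C * (C + 1)^-1)); first by rewrite ler_wpM2l// ltW.
  by rewrite ltr_pdivrMr; lra.
by rewrite ltNge h.
Qed.

End laurent_sublevel.

(** * The limit for a function of the moduli *)

Section boyd_limit.
Local Open Scope classical_set_scope.
Context {R : realType} (n k : nat) (P : 'I_k -> laurent R n).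
Hypothesis P_neq0 : forall i, P i != 0.

Lemma sub_bigsetU_ord (T : Type) (E : 'I_k -> set T) i :
  E i `<=` \big[setU/set0]_(i < k) E i.
Proof.
by move=> z Ez; rewrite -bigcup_seq; exists i => //=; rewrite mem_index_enum.
Qed.

Lemma measure_bigsetU_le d (T : measurableType d) (mu : probability T R)
    (E : 'I_k -> set T) (c : 'I_k -> R) :
  (forall i, measurable (E i)) -> (forall i, (mu (E i) <= (c i)%:E)%E) ->
  (mu (\big[setU/set0]_(i < k) E i) <= (\sum_(i < k) c i)%:E)%E.
Proof.
move=> mE h; elim: (index_enum _) => [|i r IH].
  by rewrite !big_nil measure0.
rewrite !big_cons EFinD; apply: le_trans (leeD (h i) IH).
by apply: measureU2 => //; exact: bigsetU_measurable.
Qed.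

Lemma L1_close d (T : measurableType d) (mu : {measure set T -> \bar R})
    (D : set T) (G : T -> \bar R) (f : T -> R) (e : R) :
  measurable D -> measurable_fun D G ->
  mu.-integrable D (fun z => (f z)%:E) ->
  (\int[mu]_(z in D) `|G z - (f z)%:E| <= e%:E)%E ->
  mu.-integrable D G /\
  (`|\int[mu]_(z in D) G z - \int[mu]_(z in D) (f z)%:E| <= e%:E)%E.
Proof.
move=> mD mG fi h.
have mH : measurable_fun D (fun z => G z - (f z)%:E)%E.
  by apply: emeasurable_funB => //; exact: measurable_int fi.
have iH : mu.-integrable D (fun z => G z - (f z)%:E)%E.
  by apply/integrableP; split=> //; exact: le_lt_trans h (ltry _).
have iG : mu.-integrable D G.
  apply: (eq_integrable mD _ _ _ (integrableD mD iH fi)) => z _.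
  exact: subeK.
split=> //; rewrite -integralB//.
exact: le_trans (le_abse_integral mu mD mH) h.
Qed.

Definition sublevels m (A : 'M[int]_(n, m)) j : set (m.-tuple R[i]) :=
  \big[setU/set0]_(i < k) laurent_sublevel (P i) A j.

Lemma measurable_sublevels m (A : 'M[int]_(n, m)) j : measurable (sublevels A j).
Proof. by apply: bigsetU_measurable => i _; exact: measurable_laurent_sublevel. Qed.

Lemma not_sublevels m (A : 'M[int]_(n, m)) j z : torus R m z -> ~ sublevels A j z ->
  forall i, 2^-1 ^+ j < Normc.normc (laurent_eval (P i) (torus_subst A z)).
Proof.
move=> tz nE i; rewrite ltNge; apply/negP => h; apply: nE.
by apply: (sub_bigsetU_ord (i := i)).
Qed.

Lemma sublevels_bound : exists C q M : R, [/\ 0 <= C, 0 < q < 1 &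
  forall m (A : 'M[int]_(n, m)), (M%:E <= boyd_height R A)%E -> forall j,
    (haar R m (sublevels A j) <= (C * q ^+ j)%:E)%E].
Proof.
have [C /choice[q /choice[M h]]] := choice (fun i => laurent_sublevel_bound (P_neq0 i)).
pose q' := \big[Num.max/2^-1]_(i < k) q i.
pose M' := \big[Num.max/0]_(i < k) M i.
have q'half : 2^-1 <= q' by exact: bigmax_ge_id.
exists (\sum_(i < k) C i), q', M'; split.
- by apply: sumr_ge0 => i _; have [] := h i.
- apply/andP; split; first by apply: lt_le_trans q'half; rewrite invr_gt0.
  apply/bigmax_ltP; split; first by rewrite invf_lt1 ?ltr1n.
  by move=> i _; have [_ /andP[]] := h i.
move=> m A MA j.
apply: (@le_trans _ _ (\sum_(i < k) C i * q i ^+ j)%:E).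
  apply: measure_bigsetU_le => i; first exact: measurable_laurent_sublevel.
  have [_ _] := h i; apply; apply: le_trans MA; rewrite lee_fin.
  exact: (le_bigmax _ M).
rewrite lee_fin mulr_suml; apply: ler_sum => i _.
have [C0 /andP[q0 _] _] := h i; apply: ler_wpM2l => //.
apply: lerXn2r; rewrite ?nnegrE ?(ltW q0)//; last exact: (le_bigmax _ q).
by apply: le_trans q'half; rewrite invr_ge0.
Qed.

Definition moduli (z : n.-tuple R[i]) (i : 'I_k) : R :=
  Normc.normc (laurent_eval (P i) z).

Context (B : R) (F : ('I_k -> R) -> \bar R).
Hypothesis moduli_le : forall z i, torus R n z -> moduli z i <= B.
Hypothesis F_approx : log_approximable (fun i z => moduli z i) B F.
Hypothesis F_meas : forall m (A : 'M[int]_(n, m)),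
  measurable_fun (torus R m) (fun z => F (moduli (torus_subst A z))).

(** Far from the zeros the approximation is uniform, and the sublevel sets are
so small that the logarithmic singularities contribute little, both
uniformly in A. *)
Lemma uniform_L1_approx : exists M : R, forall eps, 0 < eps ->
  exists2 f : n.-tuple R[i] -> R, is_real_trig f &
    forall m (A : 'M[int]_(n, m)), (M%:E <= boyd_height R A)%E ->
      (\int[haar R m]_(z in torus R m)
        `|F (moduli (torus_subst A z)) - (f (torus_subst A z))%:E| <= eps%:E)%E.
Proof.
have [C [q [M [C0 q01 sub_le]]]] := sublevels_bound.
have [b [r [b1 approx]]] := F_approx.
exists M => eps eps0.
have [K [s [K0 /andP[s0 s1] Ks]]] := poly_geometric r (le_trans ler01 b1) q01.
pose a := 2 * C * K.
have a0 : 0 <= a by rewrite !mulr_ge0.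
have s1' : `|s| < 1 by rewrite gtr0_norm.
have s10 : 0 < 1 - s by rewrite subr_gt0.
have e20 : 0 < eps / 2 by rewrite divr_gt0.
have d0 : 0 < eps / 2 * (1 - s) / (a + 1) by rewrite divr_gt0 ?mulr_gt0// ltr_wpDl.
have /cvgr_lt/(_ _ d0)[J _ /(_ J (leqnn J)) hJ] := cvg_expr s1'.
have [p p_trig p_approx] := approx J _ e20.
exists (fun z => p (moduli z)) => // m A MA.
rewrite [eps]splitr.
apply: (@layered_integral_le _ _ _ _ _ (sublevels A) _
  (fun j => 2 * (b + j%:R) ^+ r) (fun j => C * q ^+ j) _ _ J).
- exact: measurable_torus.
- by move=> j; exact: measurable_sublevels.
- apply: emeasurable_funB; first exact: F_meas.
  exact: measurable_int (integrable_real_trig_subst A p_trig).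
- exact: ltW.
- move=> j; have : 1 <= (b + j%:R) ^+ r by rewrite exprn_ege1// (le_trans b1)// lerDl.
  lra.
- by move=> j; exact: sub_le.
- move=> z tz nE.
  have [|_] := p_approx (moduli (torus_subst A z)); last by apply; exact: not_sublevels.
  by move=> i; apply: moduli_le; exact: torus_torus_subst.
- move=> z j tz nE.
  have [|+ _] := p_approx (moduli (torus_subst A z)); last by apply; exact: not_sublevels.
  by move=> i; apply: moduli_le; exact: torus_torus_subst.
- move=> N; apply: (@le_trans _ _ (\sum_(j < N) a * s ^+ J * s ^+ j)).
    apply: ler_sum => j _; rewrite -[leRHS]mulrA -exprD.
    have -> : 2 * (b + (J + j)%:R) ^+ r * (C * q ^+ (J + j)) =
      2 * C * ((b + (J + j)%:R) ^+ r * q ^+ (J + j)) by ring.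
    by rewrite /a -[leRHS]mulrA; apply: ler_wpM2l; [rewrite mulr_ge0|exact: Ks].
  have -> : \sum_(j < N) a * s ^+ J * s ^+ j = series (geometric (a * s ^+ J) s) N.
    by rewrite /series/= big_mkord.
  apply: le_trans (geometric_le_lim N _ s0 s1') _; first by rewrite mulr_ge0// exprn_ge0// ltW.
  rewrite ler_pdivrMr//; move: (ltW hJ); rewrite ler_pdivlMr ?ltr_wpDl// => h.
  apply: le_trans h; rewrite mulrC ler_wpM2l ?exprn_ge0 ?(ltW s0)//; lra.
Qed.

Lemma integral_torus_subst_id (f : n.-tuple R[i] -> \bar R) :
  (\int[haar R n]_(z in torus R n) f (torus_subst 1%:M z) =
   \int[haar R n]_(z in torus R n) f z)%E.
Proof. by apply: eq_integral => z _; rewrite torus_subst_id. Qed.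

(** F is L1-close to a trigonometric polynomial f both after the substitution by A
and by the identity, and the two integrals of f agree for A of large height. *)
Lemma integral_moduli_cvg : exists M : R,
  (forall m (A : 'M[int]_(n, m)), (M%:E <= boyd_height R A)%E ->
    (haar R m).-integrable (torus R m) (fun z => F (moduli (torus_subst A z)))) /\
  forall eps, 0 < eps -> exists M' : R,
    forall m (A : 'M[int]_(n, m)), (M'%:E <= boyd_height R A)%E ->
      (`|\int[haar R m]_(z in torus R m) F (moduli (torus_subst A z)) -
         \int[haar R n]_(z in torus R n) F (moduli z)| < eps%:E)%E.
Proof.
have [M approx] := uniform_L1_approx.
have close m (A : 'M[int]_(n, m)) := @L1_close _ _ (haar R m) (torus R m)
  (fun z => F (moduli (torus_subst A z))).
exists M; split=> [m A MA|eps eps0].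
  have [f hf /(_ _ _ MA) h] := approx 1 ltr01.
  by have [] := close m A _ _ (@measurable_torus R m) (F_meas A)
    (integrable_real_trig_subst A hf) h.
have e0 : 0 < eps / 3 by rewrite divr_gt0.
have [f hf fF] := approx _ e0.
have [M' M'P] := integral_real_trig_subst hf.
exists (Num.max M M') => m A; rewrite EFin_max ge_max => /andP[MA M'A].
have [iA hA] := close m A _ _ (@measurable_torus R m) (F_meas A)
  (integrable_real_trig_subst A hf) (fF m A MA).
have M1 : (M%:E <= boyd_height R (1%:M : 'M[int]_n))%E by rewrite boyd_height_id leey.
have [i1 h1] := close n 1%:M _ _ (@measurable_torus R n) (F_meas 1%:M)
  (integrable_real_trig_subst 1%:M hf) (fF n 1%:M M1).
move: hA; rewrite (M'P m A M'A).
have fin1 := integrable_fin_num (@measurable_torus R n) i1.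
have finA := integrable_fin_num (@measurable_torus R m) iA.
have finf := integrable_fin_num (@measurable_torus R n)
  (integrable_real_trig_subst 1%:M hf).
move: h1 fin1 finA finf.
rewrite (integral_torus_subst_id (fun z => F (moduli z))).
rewrite (integral_torus_subst_id (fun z => (f z)%:E)).
do 3![case: (\int[_]_(_ in _) _)%E => // ?].
rewrite -!EFinB !abse_EFin !lee_fin lte_fin !ler_norml ltr_norml.
by move=> /andP[? ?] _ _ _ /andP[? ?]; apply/andP; split; lra.
Qed.

End boyd_limit.

(** * Mahler measures *)

Section boyd_theorem.
Local Open Scope classical_set_scope.
Context {R : realType}.

Lemma measurable_lne_EFin d (T : measurableType d) (D : set T) (g : T -> R) :
  measurable D -> measurable_fun D g -> measurable_fun D (fun z => lne (g z)%:E).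
Proof.
move=> mD mg.
apply: (@measurable_comp _ _ _ _ _ _ setT (fun r : R => lne r%:E) D g) => //.
apply: measurable_fun_ifT => //=.
  by apply: measurable_fun_ler => //; exact: measurable_id.
by apply/measurable_EFinP; exact: measurable_ln.
Qed.

Lemma measurable_bigmaxe d (T : measurableType d) (D : set T) k
    (f : 'I_k -> T -> \bar R) : (forall i, measurable_fun D (f i)) ->
  measurable_fun D (fun z => (\big[maxe/-oo]_(i < k) f i z)%E).
Proof.
move=> mf; elim: (index_enum _) => [|i r IH].
  by under eq_fun do rewrite big_nil; exact: measurable_cst.
by under eq_fun do rewrite big_cons; exact: measurable_maxe.
Qed.

Lemma measurable_prode d (T : measurableType d) (D : set T) k
    (f : 'I_k -> T -> \bar R) : (forall i, measurable_fun D (f i)) ->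
  measurable_fun D (fun z => (\prod_(i < k) f i z)%E).
Proof.
move=> mf; elim: (index_enum _) => [|i r IH].
  by under eq_fun do rewrite big_nil; exact: measurable_cst.
by under eq_fun do rewrite big_cons; exact: emeasurable_funM.
Qed.

Lemma measurable_log_moduli n m k (P : 'I_k -> laurent R n) (A : 'M[int]_(n, m)) i :
  measurable_fun (torus R m) (fun z => lne (moduli P (torus_subst A z) i)%:E).
Proof.
apply: measurable_lne_EFin; first exact: measurable_torus.
apply: measurable_funTS; apply: measurable_normc.
exact: measurable_laurent_eval_subst.
Qed.

Definition moduli_bound n k (P : 'I_k -> laurent R n) : R :=
  1 + \sum_(i < k) \sum_(v <- msupp (P i)) Normc.normc (P i)@_v.

Lemma moduli_bound_ge1 n k (P : 'I_k -> laurent R n) : 1 <= moduli_bound P.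
Proof.
by rewrite lerDl sumr_ge0// => i _; apply: sumr_ge0 => v _; exact: normc_ge0.
Qed.

Lemma moduli_le_bound n k (P : 'I_k -> laurent R n) z i :
  torus R n z -> moduli P z i <= moduli_bound P.
Proof.
move=> tz; rewrite /moduli laurent_eval_trig.
apply: le_trans (normc_trig _ tz) _; rewrite big_map /moduli_bound (bigD1 i)//=.
rewrite addrCA lerDl addr_ge0// sumr_ge0// => j _; apply: sumr_ge0 => v _.
exact: normc_ge0.
Qed.

Lemma boyd_cvg_moduli n k (P : 'I_k -> laurent R n) (F : ('I_k -> R) -> \bar R) :
  (forall i, P i != 0) ->
  log_approximable (fun i z => moduli P z i) (moduli_bound P) F ->
  (forall m (A : 'M[int]_(n, m)),
    measurable_fun (torus R m) (fun z => F (moduli P (torus_subst A z)))) ->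
  ((forall i, P i != 0) /\
    (haar R n).-integrable (torus R n) (fun z => F (moduli P z))) /\
  boyd_cvg
    (fun m A => (forall i, laurent_subst (P i) A != 0) /\
      (haar R m).-integrable (torus R m)
        (fun z => F (moduli (fun i => laurent_subst (P i) A) z)))
    (fun m A => (\int[haar R m]_(z in torus R m)
        F (moduli (fun i => laurent_subst (P i) A) z))%E)
    (\int[haar R n]_(z in torus R n) F (moduli P z))%E.
Proof.
move=> P0 Fapprox Fmeas.
have [M [int_A cvg_A]] := integral_moduli_cvg P0 (@moduli_le_bound n k P) Fapprox Fmeas.
have substE m (A : 'M[int]_(n, m)) z : torus R m z ->
    F (moduli (fun i => laurent_subst (P i) A) z) = F (moduli P (torus_subst A z)).
  move=> tz; congr F; apply/funext => i; congr (Normc.normc _).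
  exact: laurent_eval_torus_subst.
split.
  split=> //; have := int_A n 1%:M; rewrite boyd_height_id leey => /(_ isT).
  by under eq_fun do rewrite torus_subst_id.
move=> eps /cvg_A[M' cvg_M'].
have [M0 hM0] := choice (fun i => laurent_subst_neq0 (P0 i)).
exists (\big[Num.max/Num.max M M']_(i < k) M0 i) => m A _ MA.
have MA' : (M%:E <= boyd_height R A)%E /\ (M'%:E <= boyd_height R A)%E.
  split; apply: le_trans MA; rewrite lee_fin; apply: le_trans (bigmax_ge_id _ _ _ _);
    by rewrite le_max lexx ?orbT.
split.
  split.
    move=> i; apply: hM0; apply: le_trans MA; rewrite lee_fin; exact: (le_bigmax _ M0).
  apply: (eq_integrable (@measurable_torus R m) _ _ _ (int_A m A MA'.1)).
  by move=> z; rewrite inE => tz; rewrite substE.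
rewrite (eq_integral (fun z => F (moduli P (torus_subst A z)))).
  exact: cvg_M' MA'.2.
by move=> z; rewrite inE => tz; exact: substE.
Qed.

End boyd_theorem.

Theorem corollary6p4 (R : realType) (n k : nat) (hn : (1 <= n)%N)
    (hk : (1 <= k)%N) (P : 'I_k -> laurent R n) (hP : forall i, P i != 0) :
  (mahler_max_defined P /\
   boyd_cvg
     (fun m A => mahler_max_defined (fun i => laurent_subst (P i) A))
     (fun m A => mahler_max (fun i => laurent_subst (P i) A))
     (mahler_max P)) /\
  (mahler_prod_defined P /\
   boyd_cvg
     (fun m A => mahler_prod_defined (fun i => laurent_subst (P i) A))
     (fun m A => mahler_prod (fun i => laurent_subst (P i) A))
     (mahler_prod P)).
Proof.
have P_trig i : is_real_trig (fun z => moduli P z i ^+ 2).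
  exact: is_real_trig_normc_sqr.
have B1 := moduli_bound_ge1 P.
split.
  apply: (boyd_cvg_moduli hP (log_approximable_max P_trig B1 hk)) => m A.
  by apply: measurable_bigmaxe => i; exact: measurable_log_moduli.
apply: (boyd_cvg_moduli hP (log_approximable_prod P_trig B1)) => m A.
by apply: measurable_prode => i; exact: measurable_log_moduli.
Qed.
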